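(* Let $\mathcal{C}$ be a Melnikov formation of finite groups, let $\Lambda$ be a $\mathcal{C}$-projective group and $\Gamma\le\Lambda$ a (pro-$\mathcal{C}$) subgroup. The pair $(\Gamma,\Lambda)$ is $\mathcal{C}$-projective if and only if for every pro-$\mathcal{C}$ group $A$ on which $\Lambda$ acts the restriction map $H^1(\Lambda,A)\to H^1(\Gamma,A)$ is surjective.
   Context: A Melnikov formation $\mathcal{C}$ is a family of finite groups closed under fiber products (with respect to epimorphisms) and such that for every short exact sequence $1\to A\to B\to C\to 1$ one has $A,C\in\mathcal{C}$ if and only if $B\in\mathcal{C}$. A pro-$\mathcal{C}$ group is a profinite group all of whose finite continuous quotients are in $\mathcal{C}$. All subgroups of profinite groups are closed, and all homomorphisms and actions are continuous (actions on groups being by automorphisms). A pro-$\mathcal{C}$ group $\Lambda$ is $\mathcal{C}$-projective if for all $G,A\in\mathcal{C}$ and all epimorphisms $\mu\colon\Lambda\to A$, $\alpha\colon G\to A$ there is a homomorphism $\theta\colon\Lambda\to G$ with $\alpha\theta=\mu$. Let $\Gamma\le\Lambda$ be pro-$\mathcal{C}$ groups. A $\mathcal{C}$-DEP for $(\Gamma,\Lambda)$ consists of groups $A\le B$ and $G\le H$, all in $\mathcal{C}$, and epimorphisms $\mu\colon\Gamma\to A$, $\alpha\colon G\to A$, $\nu\colon\Lambda\to B$, $\beta\colon H\to B$ such that $\nu|_\Gamma=\mu$ and $\beta|_G=\alpha$. A weak solution is a pair $(\eta,\theta)$ of homomorphisms $\eta\colon\Gamma\to G$, $\theta\colon\Lambda\to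 H$ (not necessarily surjective) with $\alpha\eta=\mu$, $\beta\theta=\nu$ and $\theta|_\Gamma=\eta$. The pair $(\Gamma,\Lambda)$ is $\mathcal{C}$-projective if every $\mathcal{C}$-DEP for it has a weak solution. $H^1$ is first non-abelian continuous cohomology: $H^1(\Lambda,A)$ is the set of continuous maps $x\colon\Lambda\to A$ with $x(\sigma\tau)=x(\sigma)\cdot{}^{\sigma}x(\tau)$, modulo the equivalence $x\sim y$ iff there is $a\in A$ with $y(\sigma)=a^{-1}x(\sigma)\,{}^{\sigma}a$ for all $\sigma$. *)

(* Defs.v *)
From HB Require Import structures.
From mathcomp Require Import all_boot all_fingroup all_solvable.
From mathcomp Require Import all_classical topology.

Set Implicit Arguments.
Unset Strict Implicit.
Unset Printing Implicit Defensive.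

Local Open Scope classical_set_scope.
Local Open Scope group_scope.
Local Open Scope quotient_scope.

HB.mixin Record isTopologicalGroup G of Topological G & monoid.Group G := {
  mulg_continuous : continuous (fun x : G * G => x.1 * x.2);
  invg_continuous : continuous (fun x : G => x^-1)
}.

#[short(type="topologicalGroupType")]
HB.structure Definition TopologicalGroup :=
  {G of Topological G & monoid.Group G & isTopologicalGroup G}.

Definition epi (G H : Type) (f : G -> H) := set_surj [set: G] [set: H] f.

Lemma multiplicative1 (G H : groupType) (f : {multiplicative G -> H}) : f 1 = 1.
Proof. by apply: (mulgI (f 1)); rewrite -gmulfM !mulg1. Qed.

Record closedSubgroup (L : topologicalGroupType) := ClosedSubgroup {
  csub_set : set L;
  csub_closed : closed csub_set;
  csub1 : csub_set 1;
  csubM : forall x y, csub_set x -> csub_set y -> csub_set (x * y);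
  csubV : forall x, csub_set x -> csub_set x^-1
}.

Definition csub_type (L : topologicalGroupType) (S : closedSubgroup L) : Type :=
  set_type (csub_set S).
Coercion csub_type : closedSubgroup >-> Sortclass.

Section ClosedSubgroupStructure.
Variables (L : topologicalGroupType) (S : closedSubgroup L).

HB.instance Definition _ := SubChoice.on (csub_type S).
HB.instance Definition _ := Topological.on (csub_type S).

Lemma csub_group_closed : group_closed (mem (csub_set S)).
Proof.
split; first exact/mem_set/csub1.
by move=> x y /set_mem Sx /set_mem Sy; apply/mem_set/csubM => //; exact: csubV.
Qed.

HB.instance Definition _ :=
  SubChoice_isSubGroup.Build L (mem (csub_set S)) (csub_type S)
    csub_group_closed.

Definition csub_incl (x : S) : L := \val x.

Lemma csub_inclM : {morph csub_incl : x y / x * y}.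
Proof. by []. Qed.

Lemma csub_incl_continuous : continuous csub_incl.
Proof. exact: initial_continuous. Qed.

Lemma continuous_into_csub (T : topologicalType) (f : T -> S) :
  continuous (csub_incl \o f) -> continuous f.
Proof.
move=> cf x U [_ [[W oW <-] /= Wfx WU]]; apply: (filterS WU).
by apply: (cf x); apply: open_nbhs_nbhs.
Qed.

Lemma csub_mulg_continuous : continuous (fun x : S * S => x.1 * x.2).
Proof.
apply: continuous_into_csub => x.
apply: (@continuous_comp _ _ _ (fun x : S * S => (csub_incl x.1, csub_incl x.2))
  (fun x : L * L => x.1 * x.2)); last exact: mulg_continuous.
by apply: cvg_pair; apply: continuous_comp;
  [exact: cvg_fst|exact: csub_incl_continuous
  |exact: cvg_snd|exact: csub_incl_continuous].
Qed.

Lemma csub_invg_continuous : continuous (fun x : S => x^-1).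
Proof.
apply: continuous_into_csub => x.
apply: (@continuous_comp _ _ _ csub_incl (fun x : L => x^-1)).
  exact: csub_incl_continuous.
exact: invg_continuous.
Qed.

HB.instance Definition _ :=
  isTopologicalGroup.Build (csub_type S)
    csub_mulg_continuous csub_invg_continuous.

End ClosedSubgroupStructure.

Section FiberProduct.
Variables (G1 G2 A : finGroupType).
Variables (f1 : {multiplicative G1 -> A}) (f2 : {multiplicative G2 -> A}).

Definition fiber_product : {set G1 * G2} := [set x | f1 x.1 == f2 x.2]%SET.

Lemma fiber_product_group_set : group_set fiber_product.
Proof.
apply/group_setP; split; first by rewrite inE !multiplicative1.
by move=> x y; rewrite !inE => /eqP ex /eqP ey; rewrite /= !gmulfM ex ey.
Qed.

Canonical fiber_product_group := group fiber_product_group_set.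

End FiberProduct.

(* Closure of C under isomorphism is a consequence of the second condition,
   applied to 1 -> B -> B' -> 1 -> 1. *)
Record Melnikov_formation (C : finGroupType -> Prop) : Prop := {
  Melnikov_fiber_product :
    forall (G1 G2 A : finGroupType)
      (f1 : {multiplicative G1 -> A}) (f2 : {multiplicative G2 -> A}),
    epi f1 -> epi f2 -> C G1 -> C G2 -> C (subg_of (fiber_product_group f1 f2));
  Melnikov_exact :
    forall (A B D : finGroupType)
      (i : {multiplicative A -> B}) (p : {multiplicative B -> D}),
    injective i -> epi p -> (forall b, p b = 1 <-> exists a, i a = b) ->
    C A /\ C D <-> C B
}.

Definition profinite (G : topologicalGroupType) :=
  [/\ compact [set: G], hausdorff_space G & totally_disconnected [set: G]].

Definition fin_continuous (T : topologicalType) (F : finGroupType) (f : T -> F) :=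
  continuous (f : T -> discrete_topology F).

(* Up to isomorphism, the finite continuous quotients of L are its continuous
   epimorphic images F. *)
Definition pro (C : finGroupType -> Prop) (L : topologicalGroupType) :=
  profinite L /\
  forall (F : finGroupType) (f : {multiplicative L -> F}),
    fin_continuous f -> epi f -> C F.

Definition projective_group (C : finGroupType -> Prop)
    (L : topologicalGroupType) :=
  pro C L /\
  forall (G A : finGroupType) (mu : {multiplicative L -> A})
      (alpha : {multiplicative G -> A}),
    C G -> C A -> fin_continuous mu -> epi mu -> epi alpha ->
    exists2 theta : {multiplicative L -> G},
      fin_continuous theta & forall s, alpha (theta s) = mu s.

Record DEP (C : finGroupType -> Prop) (L : topologicalGroupType)
    (Gam : closedSubgroup L) := {
  dep_B : finGroupType;
  dep_A : {group dep_B};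
  dep_H : finGroupType;
  dep_G : {group dep_H};
  dep_CA : C (subg_of dep_A);
  dep_CB : C dep_B;
  dep_CG : C (subg_of dep_G);
  dep_CH : C dep_H;
  dep_mu : {multiplicative Gam -> subg_of dep_A};
  dep_alpha : {multiplicative subg_of dep_G -> subg_of dep_A};
  dep_nu : {multiplicative L -> dep_B};
  dep_beta : {multiplicative dep_H -> dep_B};
  dep_mu_continuous : fin_continuous dep_mu;
  dep_nu_continuous : fin_continuous dep_nu;
  dep_mu_epi : epi dep_mu;
  dep_alpha_epi : epi dep_alpha;
  dep_nu_epi : epi dep_nu;
  dep_beta_epi : epi dep_beta;
  dep_nu_mu : forall g : Gam, dep_nu (csub_incl g) = sgval (dep_mu g);
  dep_beta_alpha : forall x : subg_of dep_G,
    dep_beta (sgval x) = sgval (dep_alpha x)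
}.

Definition has_weak_solution (C : finGroupType -> Prop)
    (L : topologicalGroupType) (Gam : closedSubgroup L) (E : DEP C Gam) :=
  exists (eta : {multiplicative Gam -> subg_of (dep_G E)})
         (theta : {multiplicative L -> dep_H E}),
    [/\ fin_continuous eta /\ fin_continuous theta,
        forall g, dep_alpha E (eta g) = dep_mu E g,
        forall s, dep_beta E (theta s) = dep_nu E s
      & forall g, theta (csub_incl g) = sgval (eta g)].

Definition projective_pair (C : finGroupType -> Prop)
    (L : topologicalGroupType) (Gam : closedSubgroup L) :=
  forall E : DEP C Gam, has_weak_solution E.

Record contAction (L A : topologicalGroupType) := ContAction {
  cact :> L -> A -> A;
  cact1 : forall a, cact 1 a = a;
  cactM : forall s t a, cact (s * t) a = cact s (cact t a);
  cact_morph : forall s, {morph cact s : a b / a * b};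
  cact_continuous : continuous (fun p : L * A => cact p.1 p.2)
}.

Record cocycle (L A : topologicalGroupType) (ac : contAction L A) := Cocycle {
  cocycle_fun :> L -> A;
  cocycle_continuous : continuous cocycle_fun;
  cocycleM : forall s t,
    cocycle_fun (s * t) = cocycle_fun s * ac s (cocycle_fun t)
}.

Section Cohomology.
Variables (L A : topologicalGroupType) (ac : contAction L A).

HB.instance Definition _ := gen_eqMixin (cocycle ac).
HB.instance Definition _ := gen_choiceMixin (cocycle ac).

Definition cohomologous (x y : cocycle ac) :=
  exists a : A, forall s, y s = a^-1 * x s * ac s a.

Lemma contAction_1 s : ac s 1 = 1.
Proof. by apply: (mulgI (ac s 1)); rewrite -cact_morph !mulg1. Qed.

Lemma cohomologous_refl : reflexive (fun x y => `[< cohomologous x y >]).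
Proof.
move=> x; apply/asboolP; exists 1 => s.
by rewrite contAction_1 invg1 mul1g mulg1.
Qed.

Lemma cohomologous_imp_sym x y : cohomologous x y -> cohomologous y x.
Proof.
move=> [a xy]; exists a^-1 => s.
by rewrite xy invgK !mulgA mulgV mul1g -mulgA -cact_morph mulgV contAction_1 mulg1.
Qed.

Lemma cohomologous_sym : symmetric (fun x y => `[< cohomologous x y >]).
Proof.
by move=> x y; apply/asboolP/asboolP; exact: cohomologous_imp_sym.
Qed.

Lemma cohomologous_trans : transitive (fun x y => `[< cohomologous x y >]).
Proof.
move=> y x z /asboolP[a xy] /asboolP[b yz]; apply/asboolP.
by exists (a * b) => s; rewrite yz xy cact_morph invgM !mulgA.
Qed.

Canonical cohomologous_equiv :=
  EquivRel _ cohomologous_refl cohomologous_sym cohomologous_trans.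

Definition H1 := {eq_quot cohomologous_equiv}.

HB.instance Definition _ := Choice.on H1.
HB.instance Definition _ := EqQuotient.on H1.

End Cohomology.

Section Restriction.
Variables (L A : topologicalGroupType) (Gam : closedSubgroup L).
Variable ac : contAction L A.

Lemma res_action_continuous :
  continuous (fun p : Gam * A => ac (csub_incl p.1) p.2).
Proof.
move=> p.
apply: (@continuous_comp _ _ _ (fun p : Gam * A => (csub_incl p.1, p.2))
  (fun p : L * A => ac p.1 p.2)); last exact: cact_continuous.
apply: cvg_pair; last exact: cvg_snd.
by apply: continuous_comp; [exact: cvg_fst|exact: csub_incl_continuous].
Qed.

Definition res_action : contAction Gam A :=
  @ContAction Gam A (fun g => ac (csub_incl g))
    (cact1 ac) (fun s t => cactM ac (csub_incl s) (csub_incl t))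
    (fun s => cact_morph ac (csub_incl s)) res_action_continuous.

Lemma res_cocycle_continuous (x : cocycle ac) :
  continuous (fun g : Gam => x (csub_incl g)).
Proof.
move=> g; apply: (@continuous_comp _ _ _ (@csub_incl L Gam) x).
  exact: csub_incl_continuous.
exact: cocycle_continuous.
Qed.

Definition res_cocycle (x : cocycle ac) : cocycle res_action :=
  @Cocycle Gam A res_action (fun g => x (csub_incl g))
    (@res_cocycle_continuous x)
    (fun s t => cocycleM x (csub_incl s) (csub_incl t)).

(* Does not depend on the representative chosen: see H1_restriction_pi. *)
Definition H1_restriction (c : H1 ac) : H1 res_action :=
  \pi_(H1 res_action) (res_cocycle (generic_quotient.repr c)).

Lemma H1_restriction_pi (x : cocycle ac) :
  H1_restriction (\pi_(H1 ac) x) = \pi_(H1 res_action) (res_cocycle x).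
Proof.
apply/eqmodP/asboolP.
have /eqmodP/asboolP[a xa] : generic_quotient.repr (\pi_(H1 ac) x) = x %[mod (H1 ac)].
  by rewrite reprK.
by exists a => g; exact: xa.
Qed.

End Restriction.

Arguments H1_restriction {L A} Gam ac c.

(* Main.v *)
From HB Require Import structures.
Require Import Defs.
From mathcomp Require Import all_boot all_fingroup all_solvable.
From mathcomp Require Import all_classical topology.

(** A cocycle x : Gam -> A is the same as a lift s = (x, incl) of the inclusion
    Gam -> L to the semidirect product P = A x| L, and extending x to L amounts to
    extending s to a section of the projection pr : P -> L. Among the closed
    subgroups S of P that contain s(Gam), map onto L and meet ker pr in a normal
    subgroup K of P, take a minimal one. If K <> 1, let U be an open normal
    subgroup of P not containing K and V an open normal subgroup so small that
    s(Gam)V misses K \ U. Then s(Gam) meets K trivially modulo W = V(K :&: U), so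
    a weak solution theta of the double embedding problem S/W -> S/KW must agree
    with s on Gam, and the equaliser of S -> S/W and theta o pr is smaller than S.
    Requiring K to be normal in P, hence in A, keeps K/(K :&: U) in C although C
    need not be closed under subgroups.

    Conversely, given a double embedding problem, projectivity of L yields a lift
    theta0 : L -> H of nu, and, applied to the extension of B induced from
    alpha : G -> A, a lift eta : Gam -> G of mu. The two lifts differ on Gam by a
    cocycle with values in the finite group ker beta, on which L acts through
    theta0; extending it to L up to a coboundary corrects theta0. *)

Set Implicit Arguments.
Unset Strict Implicit.
Unset Printing Implicit Defensive.

Local Open Scope classical_set_scope.
Local Open Scope group_scope.

(** * Topological preliminaries *)

Lemma fst_continuous (T U : topologicalType) : continuous (@fst T U).
Proof. by move=> z; exact: cvg_fst. Qed.

Lemma snd_continuous (T U : topologicalType) : continuous (@snd T U).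
Proof. by move=> z; exact: cvg_snd. Qed.

Lemma pair_continuous (T U V : topologicalType) (f : T -> U) (g : T -> V) :
  continuous f -> continuous g -> continuous (fun t => (f t, g t)).
Proof. by move=> cf cg t; apply: cvg_pair; [exact: cf|exact: cg]. Qed.

Lemma comp_continuous (T U V : topologicalType) (g : U -> V) (f : T -> U) :
  continuous g -> continuous f -> continuous (fun t => g (f t)).
Proof.
by move=> cg cf t; apply: (@continuous_comp _ _ _ f g); [exact: cf|exact: cg].
Qed.

(** The sets [B i] generate a proper filter, and a cluster point of that filter lies in every closed
    [B i]. *)
Lemma compact_directed_bigcap (T : topologicalType) (I : Type) (D : set I)
    (B : I -> set T) :
  compact [set: T] -> D !=set0 ->
  (forall i j, D i -> D j -> exists2 k, D k & B k `<=` B i `&` B j) ->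
  (forall i, D i -> closed (B i)) -> (forall i, D i -> B i !=set0) ->
  \bigcap_(i in D) B i !=set0.
Proof.
move=> cT D0 dir clB B0.
have FF : Filter (filter_from D B) by exact: filter_from_filter.
have PF : ProperFilter (filter_from D B) by exact: filter_from_proper.
have [|p [_ clp]] := cT _ PF; first exact: filterT.
exists p => i Di; apply: (clB i Di) => U Up.
by apply: clp => //; exists i.
Qed.

Lemma compact_image_closed (T U : topologicalType) (f : T -> U) (A : set T) :
  hausdorff_space U -> compact [set: T] -> continuous f -> closed A ->
  closed (f @` A).
Proof.
move=> hU cT cf clA; apply: compact_closed => //; apply: continuous_compact.
  exact: continuous_subspaceT.
exact: (subclosed_compact clA cT).
Qed.

(** The traces on [R] of the clopen neighbourhoods of [x] are closed and directed. Were all of them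
    nonempty, a common point would be a point of [R] not separated from [x]. *)
Lemma clopen_avoid (T : topologicalType) (x : T) (R : set T) :
  compact [set: T] -> closed R ->
  (forall y, R y -> exists U, [/\ clopen U, U x & ~ U y]) ->
  exists D, [/\ clopen D, D x & D `&` R = set0].
Proof.
move=> cT clR sepR; apply: contrapT => noD.
have [||||p pI] := @compact_directed_bigcap T _
  [set D : set T | clopen D /\ D x] (fun D => D `&` R) cT.
- by exists setT; split => //; exact: clopenT.
- move=> A B [cA Ax] [cB Bx]; exists (A `&` B); first by split => //; exact: clopenI.
  by move=> z [[]].
- by move=> A [[_ cA] _]; exact: closedI.
- move=> A [cA Ax]; apply: contrapT => /set0P/negP/negPn/eqP A0.
  by apply: noD; exists A.
have [_ Rp] := pI setT (conj (@clopenT T) I).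
have [U [cU Ux nUp]] := sepR p Rp.
by have [] := pI U (conj cU Ux).
Qed.

(* In a compact Hausdorff space the intersection Q of the clopen sets containing
   x is connected: a partition of Q into two closed sets is cut out by an open set
   whose boundary misses Q, hence misses some clopen neighbourhood of x. *)
Lemma totally_disconnected_zero_dimensional (T : topologicalType) :
  compact [set: T] -> hausdorff_space T -> totally_disconnected [set: T] ->
  zero_dimensional T.
Proof.
move=> cT hT tdT x y xy; apply: contrapT => nsep.
pose Q := [set z | forall U, clopen U -> U x -> U z].
have Qx : Q x by [].
have Qy : Q y.
  by move=> U cU Ux; apply: contrapT => nUy; apply: nsep; exists U.
suff cQ : connected Q.
  have := tdT x I; rewrite eqEsubset => -[/(_ y) + _].
  have Cy : connected_component setT x y by exists Q.
  by move=> /(_ Cy) /eqP; rewrite eq_sym (negPf xy).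
have clQ : closed Q.
  rewrite (_ : Q = \bigcap_(U in [set U | clopen U /\ U x]) U).
    by apply: closed_bigI => U [[]].
  by apply/seteqP; split => [z Qz U [cU Ux]|z Qz U cU Ux]; apply: Qz.
have main (B B' : set T) : closed B -> closed B' -> B x -> B `&` B' = set0 ->
    Q `<=` B `|` B' -> Q `&` B' = set0.
  move=> clB clB' Bx BB' QBB'.
  have nB : set_nbhs B (~` B').
    move=> z Bz; apply: open_nbhs_nbhs; split; first exact: closed_openC.
    by move=> B'z; have : (B `&` B') z by []; rewrite BB'.
  have [M nM MB'] := compact_normal hT cT clB nB.
  have BM : B `<=` M° by move=> z Bz; exact: nM.
  have [D [cD Dx DR]] : exists D, [/\ clopen D, D x &
      D `&` (closure M `&` ~` M°) = set0].
    apply: clopen_avoid => //.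
      apply: closedI; first exact: closed_closure.
      exact/open_closedC/open_interior.
    move=> z [clMz nMz]; apply: contrapT => nU.
    have Qz : Q z by move=> U cU Ux; apply: contrapT => nUz; apply: nU; exists U.
    by have [/BM|/(MB' _ clMz)] := QBB' z Qz.
  have DM : D `&` M° = D `&` closure M.
    apply/seteqP; split => z [Dz Mz]; split => //.
      by apply: subset_closure; exact: interior_subset.
    apply: contrapT => nMz.
    have : (D `&` (closure M `&` ~` M°)) z by [].
    by rewrite DR.
  have clDM : clopen (D `&` M°).
    split; first by apply: openI; [case: cD|exact: open_interior].
    by rewrite DM; apply: closedI; [case: cD|exact: closed_closure].
  rewrite -subset0 => z [Qz B'z].
  have [//|_ Mz] := Qz _ clDM; first by split => //; exact: BM.
  by apply: (MB' z) => //; apply: subset_closure; exact: interior_subset.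
move=> B [b Bb] [C oC BC] [C' cC' BC'].
have clB : closed B by rewrite BC'; exact: closedI.
have clB' : closed (Q `&` ~` C) by apply: closedI => //; exact: open_closedC.
have BB' : B `&` (Q `&` ~` C) = set0.
  by rewrite BC -subset0 => z [[_ Cz] [_ nCz]].
have QBB' : Q `<=` B `|` (Q `&` ~` C).
  move=> z Qz; have [Cz|nCz] := pselect (C z); last by right.
  by left; rewrite BC.
have BQ : B `<=` Q by rewrite BC => z [].
(* Both pieces of the partition are closed, so [main] applies with whichever one contains [x] in
   first place and empties the other. *)
have [Bx|[_ nCx]] := QBB' x Qx.
  have Q0 := main _ _ clB clB' Bx BB' QBB'.
  apply/seteqP; split => // z Qz; have [//|B'z] := QBB' z Qz.
  by have : (Q `&` (Q `&` ~` C)) z by []; rewrite Q0.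
have Q0 : Q `&` B = set0.
  by apply: (main _ _ clB' clB) => //; [rewrite setIC|rewrite setUC].
have : (Q `&` B) b by split => //; exact: BQ.
by rewrite Q0.
Qed.

Lemma zero_dimensional_hausdorff (T : topologicalType) :
  zero_dimensional T -> hausdorff_space T.
Proof.
move=> zT x y xy; apply: contrapT => /eqP /zT[U [[oU cU] Ux nUy]].
have [||z [Uz nUz]] := xy U (~` U); first exact: open_nbhs_nbhs.
  by apply: open_nbhs_nbhs; split => //; exact: closed_openC.
by [].
Qed.

(** * Homomorphisms *)

Lemma multiplicative_of_morph (G H : groupType) (f : G -> H) :
  {morph f : x y / x * y} -> exists g : {multiplicative G -> H}, g =1 f.
Proof.
move=> fM; pose g : {multiplicative G -> H} :=
  HB.pack f (isMultiplicative.Build G H f fM).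
by exists g.
Qed.

Lemma mulVg1_eq (G : groupType) (x y : G) : x^-1 * y = 1 -> x = y.
Proof. by move=> /(canRL (mulKVg _)); rewrite mulg1. Qed.

Lemma multiplicativeV (G H : groupType) (f : {multiplicative G -> H}) x :
  f x^-1 = (f x)^-1.
Proof. by apply: (mulgI (f x)); rewrite -gmulfM !mulgV multiplicative1. Qed.

Lemma epi_exP (T U : Type) (f : T -> U) : epi f <-> forall y, exists x, f x = y.
Proof.
split=> [fs y|fs y _]; last by have [x <-] := fs y; exists x.
by have [x _ <-] := fs y I; exists x.
Qed.

(** [r] is [q] composed with a set-theoretic section of [p]; the condition on kernels makes the
    composite independent of the section, hence multiplicative. *)
Lemma epi_factor (G H K : groupType) (p : {multiplicative G -> H})
    (q : {multiplicative G -> K}) :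
  epi p -> (forall x, p x = 1 -> q x = 1) ->
  exists r : {multiplicative H -> K}, forall x, r (p x) = q x.
Proof.
move=> /epi_exP/choice[s ps] pq.
have qs x : q (s (p x)) = q x.
  apply: mulVg1_eq; rewrite -multiplicativeV -gmulfM.
  by apply: pq; rewrite gmulfM multiplicativeV ps mulVg.
have [|r rE] := @multiplicative_of_morph H K (q \o s).
  by move=> x y /=; rewrite -gmulfM -[RHS]qs gmulfM !ps.
by exists r => x; rewrite rE /= qs.
Qed.

Section Image.
Variables (G : groupType) (F : finGroupType) (f : {multiplicative G -> F}).

(** The source may be infinite, so membership is a classical truth value. *)
Definition mul_image : {set F} := [set y | `[< exists x, f x = y >]]%SET.

Lemma mul_imageP y : reflect (exists x, f x = y) (y \in mul_image).
Proof. by rewrite inE; exact: asboolP. Qed.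

Lemma mul_image_group_set : group_set mul_image.
Proof.
apply/group_setP; split; first by apply/mul_imageP; exists 1; rewrite multiplicative1.
move=> x y /mul_imageP[a <-] /mul_imageP[b <-].
by apply/mul_imageP; exists (a * b); rewrite gmulfM.
Qed.

Canonical mul_image_group := group mul_image_group_set.

Lemma mul_image_corestriction :
  exists2 g : {multiplicative G -> subg_of mul_image_group},
    epi g & forall x, sgval (g x) = f x.
Proof.
have fim x : f x \in mul_image_group by apply/mul_imageP; exists x.
have [|g gE] := @multiplicative_of_morph G (subg_of mul_image_group)
  (fun x => Subg (fim x)).
  by move=> x y; apply: val_inj; rewrite /= gmulfM.
exists g => [|x]; last by rewrite gE.
apply/epi_exP => -[y yf]; have /mul_imageP[x xy] := yf.
by exists x; rewrite gE; apply: val_inj.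
Qed.

End Image.

Section Kernel.
Variables (G H : finGroupType) (f : {multiplicative G -> H}).

Definition mul_ker : {set G} := [set x | f x == 1]%SET.

Lemma mul_ker_group_set : group_set mul_ker.
Proof.
apply/group_setP; split; first by rewrite inE multiplicative1.
by move=> x y; rewrite !inE gmulfM => /eqP-> /eqP->; rewrite mulg1.
Qed.

Canonical mul_ker_group := group mul_ker_group_set.

End Kernel.

Lemma sgval_multiplicative (gT : finGroupType) (G : {group gT}) :
  exists i : {multiplicative subg_of G -> gT}, i =1 @sgval gT G.
Proof. exact: multiplicative_of_morph. Qed.

(** * Melnikov formations *)

Section Melnikov.
Variable C : finGroupType -> Prop.
Hypothesis MC : Melnikov_formation C.

Lemma Melnikov_ker_image (G H : finGroupType) (f : {multiplicative G -> H}) :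
  epi f -> C (subg_of (mul_ker_group f)) /\ C H <-> C G.
Proof.
move=> ef; have [i iE] := sgval_multiplicative (mul_ker_group f).
apply: (Melnikov_exact MC (i := i) (p := f)) => //.
  by move=> x y; rewrite !iE; exact: subg_inj.
move=> b; split=> [fb|[a <-]].
  have bK : b \in mul_ker_group f by rewrite inE; exact/eqP.
  by exists (Subg bK); rewrite iE.
by rewrite iE; have := subgP a; rewrite inE => /eqP.
Qed.

Lemma Melnikov_quotient (G H : finGroupType) (f : {multiplicative G -> H}) :
  epi f -> C G -> C H.
Proof. by move=> ef /(Melnikov_ker_image ef)[]. Qed.

(** [N] is the kernel of the coset map, which is multiplicative on all of [G] because the normaliser
    of [N] is everything. *)
Lemma Melnikov_normal (G : finGroupType) (N : {group G}) :
  (forall x y, x \in N -> y * x * y^-1 \in N) -> C G -> C (subg_of N).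
Proof.
move=> nN CG.
have nN' x : x \in 'N(N).
  apply/normP; apply/eqP; rewrite eqEcard cardJg leqnn andbT.
  apply/fintype.subsetP => _ /imsetP[z zN ->]; rewrite conjgE.
  by have := nN z x^-1 zN; rewrite invgK mulgA.
have [|p pE] := @multiplicative_of_morph G (coset_of N) (coset N).
  by move=> x y; rewrite morphM ?nN'.
have [i iE] := sgval_multiplicative N.
have [|||_] := Melnikov_exact MC (i := i) (p := p).
- by move=> x y; rewrite !iE; exact: subg_inj.
- apply/epi_exP => y; have [x _ ->] := cosetP y.
  by exists x; rewrite pE.
- move=> b; rewrite pE; split=> [/coset_idr bN|[a <-]].
    by exists (Subg (bN (nN' b))); rewrite iE.
  by rewrite iE; apply: coset_id; exact: subgP.
by move=> /(_ CG)[].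
Qed.

(** A trivial group is a quotient of any member of [C]; since [C] could be empty, a member [G] has
    to be supplied. *)
Lemma Melnikov_trivial (G F : finGroupType) :
  C G -> (forall x : F, x = 1) -> C F.
Proof.
move=> CG F1; have [|f fE] := @multiplicative_of_morph G F (fun=> 1).
  by move=> x y; rewrite mulg1.
apply: (@Melnikov_quotient G F f) => //.
by apply/epi_exP => y; exists 1; rewrite fE (F1 y).
Qed.

End Melnikov.

(** * Finite quotients of compact groups *)

Lemma fin_continuousP (T : topologicalType) (F : finGroupType) (f : T -> F) :
  fin_continuous f <-> forall A : set F, open (f @^-1` A).
Proof.
split=> [/continuousP cf A|cf]; first by apply: cf; exact: discrete_open.
by apply/continuousP => A _; exact: cf.
Qed.

(** Openness is recorded only at 1; translation spreads it to all cosets, see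
    [open_normal_coset]. *)
Record open_normal (P : topologicalGroupType) (N : set P) : Prop := {
  open_normal1 : N 1;
  open_normalM : forall x y, N x -> N y -> N (x * y);
  open_normalV : forall x, N x -> N x^-1;
  open_normalJ : forall x y, N x -> N (y * x * y^-1);
  open_normal_nbhs : nbhs 1 N
}.

Section TopologicalGroup.
Variable P : topologicalGroupType.
Implicit Types (x y : P) (N : set P).

Lemma mulg_continuous2 (T : topologicalType) (f g : T -> P) :
  continuous f -> continuous g -> continuous (fun t => f t * g t).
Proof.
move=> cf cg t.
apply: (@continuous_comp _ _ _ (fun t => (f t, g t)) (fun x : P * P => x.1 * x.2)).
  by apply: cvg_pair; [exact: cf|exact: cg].
exact: mulg_continuous.
Qed.

Lemma invg_continuous1 (T : topologicalType) (f : T -> P) :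
  continuous f -> continuous (fun t => (f t)^-1).
Proof.
by move=> cf t; apply: (@continuous_comp _ _ _ f);
  [exact: cf|exact: invg_continuous].
Qed.

Lemma nbhs_left_translate N x : nbhs 1 N -> nbhs x [set y | N (x^-1 * y)].
Proof.
move=> N1; have c : continuous (fun y : P => x^-1 * y).
  by apply: mulg_continuous2 => y; [exact: cst_continuous|].
by apply: (c x); rewrite /= mulVg.
Qed.

Lemma open_normal_coset N x : open_normal N -> open [set y | N (x^-1 * y)].
Proof.
move=> oN; rewrite openE => y Nxy.
apply: filterS (nbhs_left_translate y (open_normal_nbhs oN)) => z /= Nyz.
by have := open_normalM oN Nxy Nyz; rewrite mulgA mulgK.
Qed.

(** The witness is the set of [h] whose insertion anywhere in a product does not affect membership
    in [O]: the largest normal subgroup of which [O] is a union of cosets. *)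
Lemma clopen_open_normal (O : set P) : compact [set: P] -> clopen O -> O 1 ->
  exists2 N, open_normal N & N `<=` O.
Proof.
move=> cP cO O1.
exists [set h | forall x y, O (x * y) <-> O (x * h * y)]; last first.
  by move=> h /(_ 1 1) /=; rewrite !mulg1 mul1g => -[/(_ O1)].
split=> /=.
- by move=> x y; rewrite mulg1.
- move=> h k hO kO x y; rewrite (kO x y) -mulgA (hO x (k * y)).
  by rewrite !mulgA.
- move=> h hO x y; rewrite (hO (x * h^-1) y).
  by rewrite mulgVK.
- move=> h k hO x y; have := hO (x * k) (k^-1 * y).
  by rewrite !mulgA mulgK.
have cPP : compact ([set: P] `*` [set: P]) by exact: compact_setX.
pose Z := [set z : (P * P) * P | O (z.1.1 * z.1.2) <-> O (z.1.1 * z.2 * z.1.2)].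
have c11 : continuous (fun z : (P * P) * P => z.1.1).
  by move=> z; apply: continuous_comp; exact: cvg_fst.
have c12 : continuous (fun z : (P * P) * P => z.1.2).
  by move=> z; apply: continuous_comp; [exact: cvg_fst|exact: cvg_snd].
have c22 : continuous (fun z : (P * P) * P => z.2) by move=> z; exact: cvg_snd.
have c1 : continuous (fun z : (P * P) * P => z.1.1 * z.1.2).
  exact: mulg_continuous2.
have c2 : continuous (fun z : (P * P) * P => z.1.1 * z.2 * z.1.2).
  by apply: mulg_continuous2 => //; exact: mulg_continuous2.
have oZ : open Z.
  pose O1' := (fun z : (P * P) * P => z.1.1 * z.1.2) @^-1` O.
  pose O2' := (fun z : (P * P) * P => z.1.1 * z.2 * z.1.2) @^-1` O.
  have [o1 k1] : clopen O1' by exact: preimage_clopen.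
  have [o2 k2] : clopen O2' by exact: preimage_clopen.
  rewrite (_ : Z = (O1' `&` O2') `|` (~` O1' `&` ~` O2')).
    by apply: openU; apply: openI => //; exact: closed_openC.
  apply/seteqP; split => z; rewrite /Z /O1' /O2' /=.
    by move=> zO; case: (pselect (O (z.1.1 * z.1.2))) => h; [left|right];
      split => //; tauto.
  by tauto.
(* Tube lemma: the open set [Z] contains the compact slice over [h = 1], so it contains the slices
   over all [h] near 1. *)
have := iffLR (compact_near_coveringP _) cPP P (nbhs 1)
  (fun h z => O (z.1 * z.2) <-> O (z.1 * h * z.2)) _.
move=> /(_ _) H; apply: filterS (H _) => [h hO x y|z _].
  exact: (hO (x, y)).
apply: (open_nbhs_nbhs (p := (z, 1)) (A := Z)); split => //.
by rewrite /Z /= mulg1.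
Qed.

(** The quotient by [N] is built by hand: compactness gives a finite list meeting every coset, and a
    coset is coded by a position in that list. *)
Lemma finite_quotient N : compact [set: P] -> open_normal N ->
  exists (F : finGroupType) (f : {multiplicative P -> F}),
    [/\ fin_continuous f, epi f & forall x, f x = 1 <-> N x].
Proof.
move=> cP oN.
(* Otherwise the closed sets [B s] of points whose coset misses [s] are nonempty and directed; a
   common point [p] contradicts [s = [:: p]]. *)
have [s sN] : exists s : seq P, forall x, has (fun z => `[< N (x^-1 * z) >]) s.
  apply: contrapT => nos.
  pose B (s : seq P) := [set x | forall z, z \in s -> ~ N (x^-1 * z)].
  have [||||p /(_ [:: p] I)/(_ p)] :=
    @compact_directed_bigcap P (seq P) setT B cP.
  - by exists [::].
  - move=> s t _ _; exists (s ++ t) => // x Bx.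
    by split=> z zs; apply: Bx; rewrite mem_cat zs ?orbT.
  - move=> s _; rewrite (_ : B s =
        \bigcap_(z in [set z | z \in s]) ~` [set x | N (z^-1 * x)]).
      by apply: closed_bigI => z _; exact/open_closedC/open_normal_coset.
    apply/seteqP; split=> x xB z zs /(open_normalV oN);
      by rewrite invgM invgK; exact: (xB z).
  - move=> s _; apply: contrapT => Bs; apply: nos; exists s => x.
    apply: contrapT => nx; apply: Bs; exists x => z zs Nxz.
    by apply: nx; apply/hasP; exists z => //; exact/asboolP.
  by rewrite mem_head mulVg => /(_ isT); apply; exact: open_normal1.
pose c x := find (fun z => `[< N (x^-1 * z) >]) s.
have clt x : (c x < size s)%N by rewrite -has_find.
have NC x y : N (x^-1 * y) -> N (y^-1 * x).
  by move=> /(open_normalV oN); rewrite invgM invgK.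
have NT x y z : N (x^-1 * y) -> N (y^-1 * z) -> N (x^-1 * z).
  by move=> Nx Ny; have := open_normalM oN Nx Ny; rewrite mulgA mulgK.
have cP' x y : c x = c y <-> N (x^-1 * y).
  split=> [cxy|Nxy]; last first.
    apply: eq_find => z; apply/asboolP/asboolP; apply: NT => //.
    exact: NC.
  have /asboolP Nx := nth_find 1 (sN x); have /asboolP Ny := nth_find 1 (sN y).
  by apply: (NT _ _ _ Nx); rewrite -/(c x) cxy; exact: NC.
pose T := {i : 'I_(size s) | `[< exists x, c x = i >]}.
have cT x : `[< exists y, c y = Ordinal (clt x) >] by apply/asboolP; exists x.
pose q x : T := exist _ (Ordinal (clt x)) (cT x).
have qP x y : q x = q y <-> N (x^-1 * y).
  rewrite -cP'; split=> [/(congr1 (fun t : T => val (val t)))//|cxy].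
  by do 2!apply: val_inj.
have /choice[r qr] (t : T) : exists x, q x = t.
  by have /asboolP[x xt] := valP t; exists x; do 2!apply: val_inj.
have qM x x' y y' : q x = q x' -> q y = q y' -> q (x * y) = q (x' * y').
  move=> /qP Nx /qP Ny; apply/qP.
  have := open_normalM oN (open_normalJ oN y^-1 Nx) Ny.
  by rewrite !invgK invgM !mulgA mulgK.
pose mT (t u : T) := q (r t * r u).
have mTq x y : mT (q x) (q y) = q (x * y) by apply: qM; rewrite qr.
have mTA : associative mT.
  by move=> t u v; rewrite -(qr t) -(qr u) -(qr v) !mTq mulgA.
have mT1 : left_id (q 1) mT by move=> t; rewrite -(qr t) mTq mul1g.
have mTV : left_inverse (q 1) (fun t => q (r t)^-1) mT.
  by move=> t; rewrite -{2}(qr t) mTq mulVg.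
pose F : finGroupType := HB.pack T (Finite_isGroup.Build T mTA mT1 mTV).
have [|f fE] := @multiplicative_of_morph P F q.
  by move=> x y; rewrite -mTq.
exists F, f; split.
- apply/fin_continuousP => A; rewrite openE => x Ax.
  apply: filterS (nbhs_left_translate x (open_normal_nbhs oN)) => y /qP xy.
  by rewrite /= fE -xy -fE.
- by apply/epi_exP => t; exists (r t); rewrite fE qr.
- move=> x; rewrite fE; change (q x = q 1 <-> N x); rewrite qP mulg1; split.
    by move=> /(open_normalV oN); rewrite invgK.
  exact: open_normalV.
Qed.

End TopologicalGroup.

Section OpenNormal.
Variable P : topologicalGroupType.

Lemma open_normal_basis (U : set P) :
  compact [set: P] -> hausdorff_space P -> zero_dimensional P -> nbhs 1 U ->
  exists2 N, open_normal N & N `<=` U.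
Proof.
move=> cP hP zP U1; have [O [O1 cO] OU] := zero_dimensional_cvg hP zP cP U1.
have [N oN NO] := clopen_open_normal cP cO O1.
by exists N => //; exact: subset_trans OU.
Qed.

Lemma open_normal_preimage (Q : topologicalGroupType) (f : {multiplicative Q -> P})
    (N : set P) :
  continuous f -> open_normal N -> open_normal (f @^-1` N).
Proof.
move=> cf oN; split=> /=.
- by rewrite multiplicative1; exact: open_normal1.
- by move=> x y Nx Ny; rewrite gmulfM; exact: open_normalM.
- by move=> x Nx; rewrite multiplicativeV; exact: open_normalV.
- by move=> x y Nx; rewrite !gmulfM multiplicativeV; exact: open_normalJ.
- by apply: (cf 1); rewrite multiplicative1; exact: open_normal_nbhs.
Qed.

(** The set is the product [M V]; it is open because it contains [V], whatever the topology of
    [M]. *)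
Lemma open_normal_mul (M V : set P) :
  M 1 -> (forall x y, M x -> M y -> M (x * y)) -> (forall x, M x -> M x^-1) ->
  (forall x y, M x -> M (y * x * y^-1)) -> open_normal V ->
  open_normal [set w | exists2 u, M u & V (u^-1 * w)].
Proof.
move=> M1 MM MV MJ oV; split=> /=.
- by exists 1 => //; rewrite invg1 mulg1; exact: open_normal1.
- move=> x y [u Mu Vx] [v Mv Vy]; exists (u * v); first exact: MM.
  have := open_normalM oV (open_normalJ oV v^-1 Vx) Vy.
  by rewrite invgK invgM !mulgA mulgK.
- move=> x [u Mu Vx]; exists u^-1; first exact: MV.
  have := open_normalJ oV u (open_normalV oV Vx).
  by rewrite invgM !invgK mulgA mulgK.
- move=> x y [u Mu Vx]; exists (y * u * y^-1); first exact: MJ.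
  have := open_normalJ oV y Vx.
  by rewrite !invgM invgK !mulgA mulgVK.
- apply: filterS (open_normal_nbhs oV) => x Vx.
  by exists 1; rewrite // invg1 mul1g.
Qed.

Lemma csub_inclP (S : closedSubgroup P) (x : S) : csub_set S (csub_incl x).
Proof. exact: set_mem (valP x). Qed.

Definition csub_elt (S : closedSubgroup P) x (Sx : csub_set S x) : S :=
  exist _ x (mem_set Sx).

Lemma csub_incl_inj (S : closedSubgroup P) : injective (@csub_incl P S).
Proof. exact: val_inj. Qed.

(** A filter on [S] is pushed forward to [P]; its cluster point there lies in [S] by closedness, and
    it is a cluster point for the induced topology. *)
Lemma closedSubgroup_compact (S : closedSubgroup P) :
  compact [set: P] -> compact [set: S].
Proof.
move=> cP F PF _; have [p [_ clp]] := cP (@csub_incl P S @ F) _ filterT.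
have Sp : csub_set S p.
  apply: (csub_closed (c := S)) => U Up; have [|q [Sq Uq]] := clp (csub_set S) U _ Up.
    by apply: (@filterS _ F _ setT) => [x _|]; [exact: csub_inclP|exact: filterT].
  by exists q.
exists (csub_elt Sp); split => // A B FA [_ [[W oW <-] /= Wp WB]].
have [|q [[x Ax <-] Wx]] := clp (@csub_incl P S @` A) W _ (open_nbhs_nbhs (conj oW Wp)).
  by apply: (@filterS _ F _ A) => // x Ax; exists x.
by exists x; split => //; exact: WB.
Qed.

Lemma csub_incl_multiplicative (S : closedSubgroup P) :
  exists f : {multiplicative S -> P}, f =1 @csub_incl P S.
Proof. exact: multiplicative_of_morph. Qed.

End OpenNormal.

Lemma closed_fin_continuous_eq (T : topologicalType) (F : finGroupType)
    (f g : T -> F) :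
  fin_continuous f -> fin_continuous g -> closed [set x | f x = g x].
Proof.
move=> /fin_continuousP cf /fin_continuousP cg.
rewrite -[X in closed X]setCK; apply: open_closedC; rewrite openE => x /= fgx.
apply: (filterS (P := f @^-1` [set f x] `&` g @^-1` [set g x])).
  by move=> y /= [-> ->].
by apply: open_nbhs_nbhs; split => //; apply: openI.
Qed.

Lemma fin_continuous_comp (T U : topologicalType) (F : finGroupType)
    (f : T -> U) (g : U -> F) :
  continuous f -> fin_continuous g -> fin_continuous (g \o f).
Proof.
move=> /continuousP cf /fin_continuousP cg; apply/fin_continuousP => A.
by rewrite comp_preimage; exact/cf/cg.
Qed.

Lemma fin_continuous_sgval (T : topologicalType) (F : finGroupType)
    (G : {group F}) (f : T -> subg_of G) :
  fin_continuous f <-> fin_continuous (@sgval F G \o f).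
Proof.
rewrite !fin_continuousP; split=> cf A; first by rewrite comp_preimage; exact: cf.
rewrite (_ : f @^-1` A = (@sgval F G \o f) @^-1` (@sgval F G @` A)); first exact: cf.
apply/seteqP; split=> x /=; first by exists (f x).
by move=> [y Ay /subg_inj <-].
Qed.

(** * Sections of extensions of projective pairs *)

Section Embedding.
Variables (C : finGroupType -> Prop) (L : topologicalGroupType)
  (Gam : closedSubgroup L).
Hypotheses (MC : Melnikov_formation C) (proL : pro C L) (proG : pro C Gam).
Hypothesis (PG : projective_pair C Gam).
Variables (P A : topologicalGroupType) (pr : {multiplicative P -> L})
  (i : {multiplicative A -> P}) (s : {multiplicative Gam -> P}).
Hypotheses (cP : compact [set: P]) (hP : hausdorff_space P)
  (zP : zero_dimensional P) (proA : pro C A).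
Hypotheses (cpr : continuous pr) (ci : continuous i) (cs : continuous s).
Hypothesis (exactP : forall x, pr x = 1 <-> exists a, i a = x).
Hypothesis (prs : forall g, pr (s g) = csub_incl g).

(** A plain set rather than a [closedSubgroup], so that Zorn's lemma can be applied to complements.
    In [ps_normal] the conjugating element ranges over [P], not only over [S]. *)
Record partial_section (S : set P) : Prop := {
  ps_closed : closed S;
  ps1 : S 1;
  psM : forall x y, S x -> S y -> S (x * y);
  psV : forall x, S x -> S x^-1;
  ps_s : forall g, S (s g);
  ps_epi : forall l, exists2 h, S h & pr h = l;
  ps_normal : forall x y, S x -> pr x = 1 -> S (y * x * y^-1)
}.

(** The descent step: the new [S'] meets the kernel of [pr] exactly in [K :&: U], where [U] is
    chosen to exclude [k]. *)
Lemma partial_section_shrink S k : partial_section S -> S k -> pr k = 1 ->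
  k <> 1 -> exists S', [/\ partial_section S', S' `<=` S & ~ S' k].
Proof.
move=> sS Sk prk k1.
have [cL hL _] := proL.1; have [cG hG _] := proG.1; have [cA _ _] := proA.1.
have [U oU kU] : exists2 U, open_normal U & ~ U k.
  have [|U oU Uk] := open_normal_basis (U := ~` [set k]) cP hP zP.
    apply: open_nbhs_nbhs; split => [|/esym//].
    by apply: closed_openC; exact/accessible_closed_set1/hausdorff_accessible.
  by exists U => // /Uk; apply.
have Uopen : open U.
  by have := open_normal_coset 1 oU; under eq_set do rewrite invg1 mul1g.
pose K := [set x | S x /\ pr x = 1].
have clK : closed K.
  apply: closedI; first exact: ps_closed sS.
  rewrite (_ : (fun _ => _) = pr @^-1` [set 1])//.
  apply: (iffLR (continuous_closedP pr)) => //.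
  exact/accessible_closed_set1/hausdorff_accessible.
have K1 : K 1 by split; [exact: ps1|rewrite multiplicative1].
have KM x y : K x -> K y -> K (x * y).
  move=> [Sx px] [Sy py]; split; first exact: psM.
  by rewrite gmulfM px py mulg1.
have KV x : K x -> K x^-1.
  by move=> [Sx px]; split; [exact: psV|rewrite multiplicativeV px invg1].
have KJ x y : K x -> K (y * x * y^-1).
  move=> [Sx px]; split; first exact: ps_normal.
  by rewrite !gmulfM multiplicativeV px mulg1 mulgV.
(* s(Gam) and K \ U are disjoint compact sets; V separates them. *)
pose D := (fun z : P * Gam => (s z.2)^-1 * z.1) @` ((K `&` ~` U) `*` setT).
have clD : closed D.
  apply: compact_closed => //; apply: continuous_compact.
    apply: continuous_subspaceT; apply: mulg_continuous2.
      apply: invg_continuous1 => z; apply: continuous_comp; last exact: cs.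
      exact: cvg_snd.
    by move=> z; exact: cvg_fst.
  apply: compact_setX => //; apply: (subclosed_compact _ cP) => //.
  by apply: closedI => //; exact: open_closedC.
have [V oV VUD] : exists2 V, open_normal V & V `<=` U `&` ~` D.
  apply: open_normal_basis => //; apply: filterI; first exact: open_normal_nbhs.
  apply: open_nbhs_nbhs; split; first exact: closed_openC.
  (* 1 is not in [D]: if [s g = x] with [x] in [K], applying [pr] gives [g = 1], so [x = 1] lies in
     [U]. *)
  move=> [[x g] [[[Sx px] nUx] _] /= /(canRL (mulKVg _))].
  rewrite mulg1 => xg; apply: nUx; rewrite xg.
  have -> : g = 1 by apply: csub_incl_inj; rewrite -[LHS]prs -xg px.
  by rewrite multiplicative1; exact: open_normal1.
(* [W] is [(K :&: U) V] and [Q] is [K V]. Their traces on [S] become the kernels of [f : PS -> E]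
   and [q : PS -> B]. *)
pose W := [set w | exists2 u, (K `&` U) u & V (u^-1 * w)].
pose Q := [set w | exists2 u, K u & V (u^-1 * w)].
have oW : open_normal W.
  apply: open_normal_mul => //.
  - by split => //; exact: open_normal1.
  - by move=> x y [Kx Ux] [Ky Uy]; split; [exact: KM|exact: open_normalM].
  - by move=> x [Kx Ux]; split; [exact: KV|exact: open_normalV].
  - by move=> x y [Kx Ux]; split; [exact: KJ|exact: open_normalJ].
have oQ : open_normal Q by exact: open_normal_mul.
have WQ : W `<=` Q by move=> w [u [Ku _] Vw]; exists u.
have KQ : K `<=` Q.
  by move=> w Kw; exists w => //; rewrite mulVg; exact: open_normal1.
have KUW : K `&` U `<=` W.
  by move=> w Kw; exists w => //; rewrite mulVg; exact: open_normal1.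
have WU : W `<=` U.
  move=> w [u [_ Uu] /VUD[Uw _]].
  by have := open_normalM oU Uu Uw; rewrite mulKVg.
pose PS := ClosedSubgroup (ps_closed sS) (ps1 sS) (psM sS) (psV sS).
have cPS : compact [set: PS] by exact: closedSubgroup_compact.
have SP x : S x -> exists y : PS, csub_incl y = x.
  by move=> Sx; exists (@csub_elt P PS x Sx).
have SPS (x : PS) : S (csub_incl x) by exact: (@csub_inclP P PS).
have [j jE] := csub_incl_multiplicative PS.
have cj : continuous j by rewrite (funext jE); exact: csub_incl_continuous.
have [E [f [cf ef kf]]] := finite_quotient cPS (open_normal_preimage cj oW).
have [B [q [cq eq_ kq]]] := finite_quotient cPS (open_normal_preimage cj oQ).
have {kf}kf x : f x = 1 <-> W (csub_incl x) by rewrite kf /= jE.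
have {kq}kq x : q x = 1 <-> Q (csub_incl x) by rewrite kq /= jE.
have [beta betaf] : exists beta : {multiplicative E -> B}, forall x, beta (f x) = q x.
  by apply: epi_factor => // x /kf/WQ/kq.
have ebeta : epi beta.
  by apply/epi_exP => y; have [x <-] := iffLR (epi_exP _) eq_ y; exists (f x).
have [p pE] : exists p : {multiplicative PS -> L}, forall x, p x = pr (csub_incl x).
  by apply: multiplicative_of_morph => x y; rewrite /= -gmulfM.
have ep : epi p.
  apply/epi_exP => l; have [h Sh <-] := ps_epi sS l.
  by have [x <-] := SP h Sh; exists x; rewrite pE.
have cp : continuous p.
  rewrite (funext pE) => x; apply: continuous_comp; last exact: cpr.
  exact: csub_incl_continuous.
have [nu nuE] : exists nu : {multiplicative L -> B}, forall x, nu (p x) = q x.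
  by apply: epi_factor => // x; rewrite pE => px; apply/kq/KQ.
(* [p] is a closed map, from a compact to a Hausdorff space, so continuity of [q] descends to
   [nu]. *)
have cnu : fin_continuous nu.
  apply/fin_continuousP => Z.
  rewrite (_ : _ @^-1` _ = ~` (p @` (q @^-1` (~` Z)))).
    apply: closed_openC; apply: compact_image_closed => //.
    by rewrite preimage_setC; apply: open_closedC; exact: (iffLR (fin_continuousP q) cq).
  apply/seteqP; split => l; first by move=> Zl [x nZ xl]; apply: nZ; rewrite /= -nuE xl.
  have [x <-] := iffLR (epi_exP _) ep l.
  by move=> nZ; apply: contrapT => nZx; apply: nZ; exists x => //=; rewrite -nuE.
have enu : epi nu.
  by apply/epi_exP => y; have [x <-] := iffLR (epi_exP _) eq_ y; exists (p x).
have CB : C B by apply: (proL.2 _ nu).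
have ck : closed [set a | S (i a)].
  by apply: (iffLR (continuous_closedP i)) => //; exact: ps_closed sS.
have ki x : K x -> exists a, i a = x by move=> [_ /exactP].
have iK a : S (i a) -> K (i a) by move=> Sa; split => //; apply/exactP; exists a.
have KA1 : S (i 1) by rewrite multiplicative1; exact: ps1.
have KAM x y : S (i x) -> S (i y) -> S (i (x * y)).
  by move=> Sx Sy; rewrite gmulfM; exact: psM.
have KAV x : S (i x) -> S (i x^-1).
  by move=> Sx; rewrite multiplicativeV; exact: psV.
pose KA := @ClosedSubgroup A _ ck KA1 KAM KAV.
have KAS (a : KA) : S (i (csub_incl a)) by exact: (@csub_inclP A KA).
(* [E] is an extension of [B] by [mul_ker beta], which is an image of [K] modulo [K :&: U]. The
   latter is the image of [KA] in the finite quotient [FA] of [A], a normal subgroup by [ps_normal],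
   hence in [C]. *)
have CE : C E.
  apply/(Melnikov_ker_image MC ebeta); split => //.
  have [FA [g [cg eg kg]]] := finite_quotient cA (open_normal_preimage ci oU).
  have CFA : C FA by exact: (proA.2 _ g).
  have [gK gKE] : exists gK : {multiplicative KA -> FA},
      forall a, gK a = g (csub_incl a).
    by apply: multiplicative_of_morph => x y; rewrite -gmulfM.
  have CN : C (subg_of (mul_image_group gK)).
    apply: Melnikov_normal => // x y /mul_imageP[a <-].
    have [b <-] := iffLR (epi_exP _) eg y.
    have Sb : S (i (b * csub_incl a * b^-1)).
      rewrite !gmulfM multiplicativeV; apply: ps_normal => //.
      by have [] := iK _ (KAS a).
    apply/mul_imageP; exists (@csub_elt A KA _ Sb).
    by rewrite !gKE -multiplicativeV -!gmulfM.
  have [gN egN gNE] := mul_image_corestriction gK.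
  pose t (a : KA) : PS := @csub_elt P PS _ (KAS a).
  have tM : {morph t : x y / x * y}.
    by move=> x y; apply: csub_incl_inj; rewrite [LHS]gmulfM.
  have tker a : f (t a) \in mul_ker_group beta.
    by rewrite inE betaf; apply/eqP/kq/KQ/iK.
  have [fN fNE] : exists fN : {multiplicative KA -> subg_of (mul_ker_group beta)},
      forall a, fN a = Subg (tker a).
    by apply: multiplicative_of_morph => x y; apply: val_inj; rewrite /= tM gmulfM.
  have [r rE] : exists r : {multiplicative subg_of (mul_image_group gK) ->
      subg_of (mul_ker_group beta)}, forall a, r (gN a) = fN a.
    apply: epi_factor => // a /(congr1 val); rewrite /= gNE gKE => /kg Ua.
    rewrite fNE; apply: val_inj => /=; apply/kf/KUW; split => //.
    exact: iK.
  apply: (Melnikov_quotient MC (f := r)) => //.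
  (* An element of the kernel is [f x] with [x] in [K V]; dropping the factor in [V], which [f]
     kills, leaves a value of [f] on [K]. *)
  apply/epi_exP => -[e ke].
  have [x xe] := iffLR (epi_exP _) ef e.
  have : beta e = 1 by apply/eqP; have := ke; rewrite inE.
  rewrite -{1}xe betaf => /kq[u Ku Vu].
  have [a au] := ki u Ku.
  have Sa : S (i a) by rewrite au; case: Ku.
  exists (gN (@csub_elt A KA a Sa)); rewrite rE fNE; apply: val_inj => /=.
  rewrite -xe; apply: mulVg1_eq.
  rewrite -multiplicativeV -gmulfM; apply/kf; exists 1.
    by split => //; exact: open_normal1.
  by rewrite invg1 mul1g /csub_incl /= au.
have [sS' sS'E] : exists sS' : {multiplicative Gam -> PS},
    forall g, csub_incl (sS' g) = s g.
  pose t g := @csub_elt P PS _ (ps_s sS g).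
  have [|t' tE] := @multiplicative_of_morph Gam PS t.
    by move=> x y; apply: csub_incl_inj; rewrite [LHS]gmulfM.
  by exists t' => g; rewrite tE.
have csS : continuous sS'.
  apply: continuous_into_csub; rewrite (_ : _ \o _ = s)//.
  exact/funext.
have [fs fsE] : exists fs : {multiplicative Gam -> E}, fs =1 f \o sS'.
  by apply: multiplicative_of_morph => x y; rewrite /= !gmulfM.
have [qs qsE] : exists qs : {multiplicative Gam -> B}, qs =1 q \o sS'.
  by apply: multiplicative_of_morph => x y; rewrite /= !gmulfM.
(* The subgroups of the double embedding problem are the images of [s(Gam)] in [E] and in [B]. *)
have [eta0 eeta0 eta0E] := mul_image_corestriction fs.
have [mu emu muE] := mul_image_corestriction qs.
have ceta0 : fin_continuous eta0.
  apply/fin_continuous_sgval; rewrite (_ : _ \o _ = f \o sS').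
    exact: fin_continuous_comp.
  by apply/funext => g; rewrite /= eta0E fsE.
have cmu : fin_continuous mu.
  apply/fin_continuous_sgval; rewrite (_ : _ \o _ = q \o sS').
    exact: fin_continuous_comp.
  by apply/funext => g; rewrite /= muE qsE.
have [alpha alphaE] : exists alpha : {multiplicative
    subg_of (mul_image_group fs) -> subg_of (mul_image_group qs)},
    forall g, alpha (eta0 g) = mu g.
  apply: epi_factor => // g /(congr1 val); rewrite /= eta0E fsE /= => fg.
  by apply: val_inj; rewrite /= muE qsE /=; apply/kq/WQ/kf.
have ealpha : epi alpha.
  by apply/epi_exP => y; have [g <-] := iffLR (epi_exP _) emu y; exists (eta0 g).
(* Here the choice of [V] pays off: if [s g = u v] with [u] in [K] and [v] in [V], then [u] outside
   [U] would put the inverse of [v] in [D]. So [s g] lies in [W], and [alpha] is injective. *)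
have alpha_inj g : mu g = 1 -> eta0 g = 1.
  move=> /(congr1 val); rewrite /= muE qsE /= => /kq[u Ku]; rewrite sS'E => Vu.
  apply: val_inj; rewrite /= eta0E fsE /=; apply/kf.
  rewrite sS'E; exists u => //; split => //; apply: contrapT => nUu.
  have [_] := VUD _ (open_normalV oV Vu).
  by apply; exists (u, g) => //=; rewrite invgM invgK.
pose dep := @Build_DEP C L Gam B (mul_image_group qs) E (mul_image_group fs)
  (proG.2 _ mu cmu emu) CB (proG.2 _ eta0 ceta0 eeta0) CE mu alpha nu beta
  cmu cnu emu ealpha enu ebeta.
have nu_mu g : nu (csub_incl g) = sgval (mu g).
  by rewrite muE qsE /= -nuE pE sS'E prs.
have beta_alpha x : beta (sgval x) = sgval (alpha x).
  have [g <-] := iffLR (epi_exP _) eeta0 x.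
  by rewrite alphaE eta0E muE fsE qsE /= betaf.
have [eta [theta [[ceta ctheta] alphaeta betatheta thetaeta]]] :=
  PG (dep nu_mu beta_alpha).
rewrite /= in eta theta ceta ctheta alphaeta betatheta thetaeta.
(* Both [eta g] and [eta0 g] lie over [mu g], so injectivity of [alpha] identifies them. *)
have thetas g : theta (csub_incl g) = f (sS' g).
  rewrite thetaeta -[RHS]fsE -eta0E; congr sgval.
  have [h hE] := iffLR (epi_exP _) eeta0 (eta g).
  apply: mulVg1_eq; rewrite -hE -multiplicativeV -gmulfM; apply: alpha_inj.
  by rewrite gmulfM multiplicativeV -(alphaE h) hE alphaeta mulVg.
pose S' := [set h | exists2 x : PS, csub_incl x = h & f x = theta (pr h)].
have S'K h : S' h -> pr h = 1 -> U h.
  by move=> [x <- fx] px; move: fx; rewrite px multiplicative1 => /kf/WU.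
have KS' h : K h -> U h -> S' h.
  move=> [Sh px] Uh; have [x xh] := SP h Sh; exists x => //.
  by rewrite px multiplicative1; apply/kf; rewrite xh; exact: KUW.
have S'S : S' `<=` S by move=> h [x <- _].
exists S'; split => //; last by move=> /S'K/(_ prk).
split.
- rewrite (_ : S' = @csub_incl P PS @` [set x | f x = (theta \o p) x]).
    apply: compact_image_closed => //; first exact: csub_incl_continuous.
    by apply: closed_fin_continuous_eq => //; exact: fin_continuous_comp.
  apply/seteqP; split=> h [x].
    by move=> xh fx; exists x => //=; rewrite pE xh.
  by move=> /= fx <-; exists x => //; rewrite -pE.
- by apply: KS' => //; exact: open_normal1.
- move=> _ _ [x <- fx] [y <- fy]; exists (x * y) => //.
  by rewrite !gmulfM fx fy.
- move=> _ [x <- fx]; exists x^-1 => //.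
  by rewrite !multiplicativeV fx.
- by move=> g; exists (sS' g); rewrite // prs thetas.
(* With [f y = theta l], the elements [x] and [y] agree modulo [K V]. Multiplying [x] by the factor
   [z] in [K] keeps it over [l] and moves its image under [f] to [theta l]. *)
- move=> l; have [x xl] := iffLR (epi_exP _) ep l.
  have [y yl] := iffLR (epi_exP _) ef (theta l).
  have : q (x^-1 * y) = 1.
    rewrite gmulfM multiplicativeV -(betaf y) yl betatheta -xl nuE.
    by rewrite mulVg.
  move=> /kq[u [Su pu] Vu]; have [z zu] := SP u Su.
  exists (csub_incl (x * z)); last by rewrite -pE gmulfM xl pE zu pu mulg1.
  exists (x * z) => //; rewrite -pE gmulfM (pE z) zu pu mulg1 xl -yl.
  apply: mulVg1_eq; rewrite -multiplicativeV -gmulfM; apply/kf; exists 1.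
    by split => //; exact: open_normal1.
  by move: Vu; rewrite invg1 mul1g -zu invgM mulgA.
- move=> x y S'x px; apply: KS'; first by apply: KJ; split => //; exact: S'S.
  by apply: open_normalJ => //; exact: S'K.
Qed.

(** Zorn's lemma is applied to complements, whose unions are complements of intersections.
    Surjectivity onto [L] survives in the limit because the fibres of [pr] are compact. *)
Lemma minimal_partial_section : epi pr ->
  exists2 S, partial_section S & forall x, S x -> pr x = 1 -> x = 1.
Proof.
move=> epr; have [cL hL _] := proL.1.
have [|T [sT Tmax]] := @Zorn_bigcup P [set T | partial_section (~` T)].
  move=> F FP Ftot.
  rewrite /= setC_bigcup; split.
  - apply: closed_bigI => T /FP sT; exact: ps_closed sT.
  - by move=> T /FP sT; exact: ps1 sT.
  - by move=> x y xF yF T FT; apply: (psM (FP T FT)); [exact: xF|exact: yF].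
  - by move=> x xF T FT; apply: (psV (FP T FT)); exact: xF.
  - by move=> g T /FP sT; exact: (ps_s sT g).
  (* The empty chain yields all of [P], whose surjectivity is the hypothesis on [pr]. *)
  - move=> l; have [F0|F0] := pselect (F !=set0); last first.
      have [h hl] := iffLR (epi_exP _) epr l; exists h => // T FT.
      by exfalso; apply: F0; exists T.
    have [|||h hF] := @compact_directed_bigcap P _ F
        (fun T => ~` T `&` pr @^-1` [set l]) cP F0.
    + move=> T1 T2 F1 F2; have [T12|T21] := Ftot T1 T2 F1 F2.
        by exists T2 => // x [nx px]; split; split => // /T12.
      by exists T1 => // x [nx px]; split; split => // /T21.
    + move=> T /FP sT; apply: closedI; first exact: ps_closed sT.
      apply: (iffLR (continuous_closedP pr)) => //.
      exact/accessible_closed_set1/hausdorff_accessible.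
    + by move=> T /FP sT; have [h Sh hl] := ps_epi sT l; exists h.
    exists h => [T FT|]; first by have [] := hF T FT.
    by have [T FT] := F0; have [] := hF T FT.
  - by move=> x y xF px T FT; apply: (ps_normal (FP T FT)) => //; exact: xF.
exists (~` T) => // x nTx px; apply: contrapT => x1.
have [S' [sS' S'T nS'x]] := partial_section_shrink sT nTx px x1.
apply: (Tmax (~` S')); last by rewrite /= setCK.
split; first by move=> y Ty S'y; exact: (S'T y S'y).
by move=> /(_ x nS'x).
Qed.

(** A minimal [S] maps bijectively onto [L], and [sg] is the inverse; compactness makes it
    continuous. *)
Lemma projective_pair_section : epi pr ->
  exists sg : {multiplicative L -> P}, [/\ continuous sg,
    forall l, pr (sg l) = l & forall g, sg (csub_incl g) = s g].
Proof.
move=> epr; have [cL hL _] := proL.1.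
have [S sS S1] := minimal_partial_section epr.
have Sinj x y : S x -> S y -> pr x = pr y -> x = y.
  move=> Sx Sy pxy; apply: mulVg1_eq; apply: S1.
    by apply: psM => //; exact: psV.
  by rewrite gmulfM multiplicativeV pxy mulVg.
have /choice[t tP] l : exists h, S h /\ pr h = l.
  by have [h] := ps_epi sS l; exists h.
have [|sg sgE] := @multiplicative_of_morph L P t.
  move=> x y; have [Sx px] := tP x; have [Sy py] := tP y; have [Sxy pxy] := tP (x * y).
  by apply: Sinj => //; [exact: psM|rewrite gmulfM px py].
have sgS l : S (sg l) by rewrite sgE; case: (tP l).
have prsg l : pr (sg l) = l by rewrite sgE; case: (tP l).
exists sg; split => [|//|g]; last first.
  by apply: Sinj => //; [exact: ps_s|rewrite prsg prs].
apply/continuous_closedP => Z cZ.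
rewrite (_ : _ @^-1` _ = pr @` (S `&` Z)).
  by apply: compact_image_closed => //; apply: closedI => //; exact: ps_closed sS.
apply/seteqP; split=> [l Zl|_ [h [Sh Zh] <-]].
  by exists (sg l).
by rewrite /= (Sinj (sg (pr h)) h) // prsg.
Qed.

End Embedding.

(** * Semidirect products *)

(** An alias indexed by the action, so that the twisted product does not compete with the
    componentwise group structure on pairs. *)
Definition semidirect (L A : topologicalGroupType) (ac : contAction L A) : Type :=
  (A * L)%type.

Section Semidirect.
Variables (L A : topologicalGroupType) (ac : contAction L A).
Local Notation sd := (semidirect ac).

HB.instance Definition _ := Topological.copy sd (A * L)%type.

Definition sd_mul (x y : sd) : sd := (x.1 * ac x.2 y.1, x.2 * y.2).
Definition sd_one : sd := (1, 1).
Definition sd_inv (x : sd) : sd := (ac x.2^-1 x.1^-1, x.2^-1).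

Lemma sd_mulA : associative sd_mul.
Proof.
by move=> x y z; rewrite /sd_mul /= cactM cact_morph !mulgA.
Qed.

Lemma sd_mul1 : left_id sd_one sd_mul.
Proof. by move=> [a l]; rewrite /sd_mul /= cact1 !mul1g. Qed.

Lemma sd_mulr1 : right_id sd_one sd_mul.
Proof. by move=> [a l]; rewrite /sd_mul /= contAction_1 !mulg1. Qed.

Lemma sd_mulV : left_inverse sd_one sd_inv sd_mul.
Proof.
by move=> [a l]; rewrite /sd_mul /sd_inv /= -cact_morph !mulVg contAction_1.
Qed.

Lemma sd_mulrV : right_inverse sd_one sd_inv sd_mul.
Proof.
by move=> [a l]; rewrite /sd_mul /sd_inv /= -cactM !mulgV cact1 mulgV.
Qed.

HB.instance Definition _ := isGroup.Build sd
  sd_mulA sd_mul1 sd_mulr1 sd_mulV sd_mulrV.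

Lemma cact_continuous2 (T : topologicalType) (f : T -> L) (g : T -> A) :
  continuous f -> continuous g -> continuous (fun t => ac (f t) (g t)).
Proof.
move=> cf cg.
apply: (@comp_continuous _ _ _ (fun p : L * A => ac p.1 p.2) (fun t => (f t, g t))).
  exact: cact_continuous.
exact: pair_continuous.
Qed.

Lemma sd_mul_continuous : continuous (fun x : sd * sd => x.1 * x.2).
Proof.
have c1 : continuous (fun x : sd * sd => x.1.1).
  exact: (comp_continuous (@fst_continuous A L) (@fst_continuous sd sd)).
have c2 : continuous (fun x : sd * sd => x.1.2).
  exact: (comp_continuous (@snd_continuous A L) (@fst_continuous sd sd)).
have c3 : continuous (fun x : sd * sd => x.2.1).
  exact: (comp_continuous (@fst_continuous A L) (@snd_continuous sd sd)).
have c4 : continuous (fun x : sd * sd => x.2.2).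
  exact: (comp_continuous (@snd_continuous A L) (@snd_continuous sd sd)).
apply: (@pair_continuous (sd * sd)%type A L); last exact: mulg_continuous2.
by apply: mulg_continuous2 => //; exact: cact_continuous2.
Qed.

Lemma sd_inv_continuous : continuous (fun x : sd => x^-1).
Proof.
have c2 : continuous (fun x : sd => x.2^-1).
  by apply: invg_continuous1; exact: (@snd_continuous A L).
apply: (@pair_continuous sd A L) => //; apply: cact_continuous2 => //.
by apply: invg_continuous1; exact: (@fst_continuous A L).
Qed.

HB.instance Definition _ :=
  isTopologicalGroup.Build sd sd_mul_continuous sd_inv_continuous.

Lemma sd_zero_dimensional :
  zero_dimensional A -> zero_dimensional L -> zero_dimensional sd.
Proof.
move=> zA zL [a l] [b m] ab; have [abE|neab] := eqVneq a b.
  have [|U [cU Ul nUm]] := zL l m.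
    by apply: contraNneq ab => ->; rewrite abE.
  exists (@snd A L @^-1` U); split => //.
  by apply: preimage_clopen => //; exact: snd_continuous.
have [U [cU Ul nUm]] := zA a b neab.
exists (@fst A L @^-1` U); split => //.
by apply: preimage_clopen => //; exact: fst_continuous.
Qed.

End Semidirect.

(** * Extending cocycles from a projective pair *)

Lemma projective_pair_H1_restriction_epi (C : finGroupType -> Prop)
    (L : topologicalGroupType) (Gam : closedSubgroup L)
    (A : topologicalGroupType) (ac : contAction L A) :
  Melnikov_formation C -> pro C L -> pro C Gam -> projective_pair C Gam ->
  pro C A -> epi (H1_restriction Gam ac).
Proof.
move=> MC proL proG PG proA; apply/epi_exP => c.
have [x <-] : exists x, \pi_(H1 (res_action Gam ac))%qT x = c.
  by exists (generic_quotient.repr c); rewrite reprK.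
pose sd : topologicalGroupType := semidirect ac.
have [cL hL tL] := proL.1; have [cA hA tA] := proA.1.
have [pr prE] : exists pr : {multiplicative sd -> L}, pr =1 (fun z : sd => z.2).
  exact: multiplicative_of_morph.
have [i iE] : exists i : {multiplicative A -> sd}, i =1 (fun a => (a, 1)).
  apply: multiplicative_of_morph => a b; congr pair; last by rewrite mulg1.
  by rewrite /= cact1.
have [s sE] : exists s : {multiplicative Gam -> sd},
    s =1 (fun g => (x g, csub_incl g)).
  apply: multiplicative_of_morph => g h; congr pair.
  by rewrite cocycleM.
have cstA : continuous (fun _ : A => 1 : L) by move=> a; exact: cst_continuous.
have zsd : zero_dimensional sd.
  by apply: sd_zero_dimensional; exact: totally_disconnected_zero_dimensional.
have csd : compact [set: sd].
  have := compact_setX cA cL; rewrite (_ : [set: A] `*` [set: L] = setT)//.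
  by apply/seteqP; split.
have [||||||sg [csg prsg sgs]] := @projective_pair_section C L Gam MC proL proG PG
  sd A pr i s csd (zero_dimensional_hausdorff zsd) zsd proA.
- by rewrite (funext prE); exact: (@snd_continuous A L).
- by rewrite (funext iE); exact: (@pair_continuous A A L _ _ (fun a => cvg_id)).
- rewrite (funext sE); apply: (@pair_continuous Gam A L).
    exact: cocycle_continuous.
  exact: csub_incl_continuous.
- move=> [a l]; rewrite prE /=; split=> [->|[b]]; first by exists a; rewrite iE.
  by rewrite iE => -[].
- by move=> g; rewrite prE sE.
- by apply/epi_exP => l; exists (1, l); rewrite prE.
have sg2 l : (sg l).2 = l by rewrite -prE.
have cy : continuous (fun l => (sg l).1).
  exact: (comp_continuous (@fst_continuous A L) csg).
have yM l m : (sg (l * m)).1 = (sg l).1 * ac l (sg m).1.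
  by rewrite gmulfM /= sg2.
exists (\pi_(H1 ac)%qT (Cocycle cy yM)); rewrite H1_restriction_pi.
(* The section extends [s] exactly, so the new cocycle restricts to [x] itself and the coboundary is
   trivial. *)
apply/eqmodP/asboolP; exists 1 => g.
by rewrite contAction_1 invg1 mul1g mulg1 /= sgs sE.
Qed.

(** * Induced extensions *)

Lemma subg_of_sub (gT : finGroupType) (H G : {group gT}) : H \subset G ->
  exists f : {multiplicative subg_of H -> subg_of G},
    forall x, sgval (f x) = sgval x.
Proof.
move=> /fintype.subsetP HG.
have [|f fE] := @multiplicative_of_morph (subg_of H) (subg_of G)
  (fun x => Subg (HG _ (subgP x))).
  by move=> x y; apply: val_inj.
by exists f => x; rewrite fE.
Qed.

(* The extension G -> A pulled back to the A-torsors Ax, x in a right transversal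
   T of A in B, is the map ext_proj from ext_space = G x T to B. Its symmetries
   lifting right translations of B form an extension of B by ker(alpha)^T
   (Kaloujnine-Krasner), whose part over A maps to G by evaluation at (1, 1). *)
Section InducedExtension.
Variables (B : finGroupType) (A : {group B}) (G : finGroupType).
Variable alpha : {multiplicative G -> subg_of A}.
Hypothesis ealpha : epi alpha.

(** One element for each right coset of [A]: the one that [repr] picks there. *)
Definition transversal_rep := {x : B | repr (A :* x) == x}.
Local Notation T := transversal_rep.

Lemma transversal_rep_inj (x y : T) : val x * (val y)^-1 \in A -> x = y.
Proof.
rewrite -mem_rcoset => xy; apply: val_inj.
by rewrite -(eqP (valP x)) -(eqP (valP y)) (rcoset_eqP xy).
Qed.

Lemma transversal_repP b : exists x : T, b * (val x)^-1 \in A.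
Proof.
have bA : repr (A :* b) \in A :* b by exact/mem_repr/rcoset_refl.
have rx : repr (A :* repr (A :* b)) == repr (A :* b) by rewrite (rcoset_eqP bA).
exists (exist (fun x : B => repr (A :* x) == x) _ rx).
by rewrite -mem_rcoset /= (rcoset_eqP bA) rcoset_refl.
Qed.

Lemma transversal_rep1 : repr (A :* 1) == 1 :> B.
Proof. by rewrite rcoset1 repr_group. Qed.

Definition rep1 : T := exist (fun x : B => repr (A :* x) == x) 1 transversal_rep1.

Definition ext_space : finType := (G * T)%type.
Local Notation Y := ext_space.

Definition ext_proj (y : Y) : B := sgval (alpha y.1) * val y.2.

(** Permutations compose from left to right, in accordance with right translations, so both
    coordinates multiply in the same order. Commuting with left multiplication by [G] reduces a
    permutation to its values at the points [(1, x)]. *)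
Definition induced_ext : {set B * {perm Y}} :=
  [set e : B * {perm Y} | [forall y, ext_proj (e.2 y) == ext_proj y * e.1] &&
    [forall g, forall y : Y,
      e.2 ((g * y.1, y.2) : Y) == (g * (e.2 y).1, (e.2 y).2)]]%SET.

Lemma induced_extP (e : B * {perm Y}) :
  reflect ((forall y, ext_proj (e.2 y) = ext_proj y * e.1) /\
    forall g x h, e.2 ((g * h, x) : Y) = (g * (e.2 (h, x)).1, (e.2 (h, x)).2))
    (e \in induced_ext).
Proof.
rewrite inE; apply: (iffP andP) => -[pe ge].
  split=> [y|g x h]; first exact/eqP/(forallP pe).
  exact/eqP/(forallP (forallP ge g) (h, x)).
split; first by apply/forallP => y; apply/eqP.
by apply/forallP => g; apply/forallP => -[h x]; apply/eqP.
Qed.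

Lemma induced_ext_group_set : group_set induced_ext.
Proof.
apply/group_setP; split.
  by apply/induced_extP; split=> [y|g x h]; rewrite !perm1 ?mulg1.
move=> e f /induced_extP[pe ge] /induced_extP[pf gf].
apply/induced_extP; split=> [y|g x h]; rewrite /= !permM.
  by rewrite pf pe mulgA.
by rewrite ge gf; case: (e.2 (h, x)).
Qed.

Canonical induced_ext_group := group induced_ext_group_set.
Local Notation E := induced_ext_group.

(** A filtration of the kernel of the map to [B], trivial for the empty list and everything for the
    full enumeration of [T]; it allows an induction one coset at a time. *)
Definition induced_ker (s : seq T) : {set B * {perm Y}} :=
  [set e : B * {perm Y} | (e \in induced_ext) && ((e.1 == 1) &&
    [forall x : T, (x \in s) || (e.2 ((1, x) : Y) == (1, x))])]%SET.

Lemma induced_kerP s (e : B * {perm Y}) :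
  reflect [/\ e \in E, e.1 = 1 & forall x, x \notin s -> e.2 (1, x) = (1, x)]
    (e \in induced_ker s).
Proof.
rewrite [X in reflect _ X]inE; apply: (iffP and3P) => -[Ee e1 es]; split => //; try exact/eqP.
  by move=> x xs; have := forallP es x; rewrite (negPf xs) => /eqP.
by apply/forallP => x; case: (boolP (x \in s)) => //= /es/eqP.
Qed.

Lemma induced_ker_group_set s : group_set (induced_ker s).
Proof.
apply/group_setP; split.
  by apply/induced_kerP; split => // x _; rewrite perm1.
move=> e f /induced_kerP[Ee e1 es] /induced_kerP[Ef f1 fs].
apply/induced_kerP; split; first exact: groupM.
  by rewrite /= e1 f1 mulg1.
by move=> x xs; rewrite /= permM es ?fs.
Qed.

Canonical induced_ker_group s := group (induced_ker_group_set s).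

(** Over the identity of [B] the point [(1, x)] keeps its projection [val x], and [x] is the only
    representative of its coset. *)
Lemma induced_ker_eval s (e : B * {perm Y}) x : e \in induced_ker s ->
  (e.2 (1, x)).2 = x /\ alpha (e.2 (1, x)).1 = 1.
Proof.
move=> /induced_kerP[/induced_extP[pe _] e1 _].
have := pe (1, x); rewrite e1 mulg1 /ext_proj /= multiplicative1 mul1g.
case: (e.2 (1, x)) => g y /= gy.
have yx : y = x by apply/esym/transversal_rep_inj; rewrite /= -gy mulgK subgP.
split => //; apply: val_inj; apply: (mulIg (val x)).
by rewrite /= mul1g -[in LHS]yx gy.
Qed.

Lemma induced_ext_epi b : exists2 e, e \in E & e.1 = b.
Proof.
have /choice[r rP] (x : T) := transversal_repP (val x * b).
have /choice[c cE] (x : T) : exists g, sgval (alpha g) = val x * b * (val (r x))^-1.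
  by have [g gE] := iffLR (epi_exP _) ealpha (Subg (rP x)); exists g; rewrite gE.
(* Since [val x * b = alpha (c x) * val (r x)], this map covers right translation by [b], and it
   visibly commutes with left multiplication by [G]. *)
pose f (y : Y) : Y := (y.1 * c y.2, r y.2).
have finj : injective f.
  move=> [g x] [h y] [gh rxy].
  have xy : x = y.
    apply: transversal_rep_inj.
    have := groupM (rP x) (groupVr (rP y)).
    by rewrite rxy !invgM !mulgA !invgK mulgVK mulgK.
  by move: gh; rewrite xy => /mulIg ->.
exists (b, perm finj) => //; apply/induced_extP; split=> [y|g x h]; rewrite /= !permE.
  by rewrite /ext_proj /= gmulfM /= cE -!mulgA mulVg mulg1.
by rewrite /f /= mulgA.
Qed.

Lemma induced_ker_nil (e : B * {perm Y}) : e \in induced_ker [::] -> e = 1.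
Proof.
case: e => b e /induced_kerP[/induced_extP[_ ge] /= -> es].
congr pair; apply/permP => -[g x]; rewrite perm1.
by rewrite -{1}[g]mulg1 ge es ?mulg1.
Qed.

(** The witness multiplies by [m] on the right over [x] and is the identity elsewhere. *)
Lemma induced_ker_surj s x (m : G) : x \in s -> alpha m = 1 ->
  exists2 e, e \in induced_ker s &
    e.2 (1, x) = (m, x) /\ forall y, y != x -> e.2 (1, y) = (1, y).
Proof.
move=> xs m1.
pose f (y : Y) : Y := (if y.2 == x then y.1 * m else y.1, y.2).
have finj : injective f.
  by move=> [g y] [h z] [+ yz]; rewrite yz; case: eqP => _ => [/mulIg|] ->.
have fE y : y != x -> f (1, y) = (1, y) by move=> /negPf yx; rewrite /f /= yx.
exists (1, perm finj).
  apply/induced_kerP; split => //= [|y ys]; last first.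
    by rewrite permE fE //; apply: contraNneq ys => ->.
  apply/induced_extP; split=> [[g y]|g y h]; rewrite /= !permE /f /=.
    by rewrite mulg1 /ext_proj /=; case: eqP => // _; rewrite gmulfM m1 mulg1.
  by case: eqP => // _; rewrite mulgA.
by split=> [|y yx]; rewrite /= permE ?(fE y)// /f /= eqxx mul1g.
Qed.

Variable C : finGroupType -> Prop.
Hypotheses (MC : Melnikov_formation C) (CG : C G) (CB : C B).

(** Evaluation at [(1, x)] maps the group for [x :: s] onto the kernel of [alpha], with kernel the
    group for [s]; closure under extensions gives the induction. *)
Lemma induced_ker_Melnikov (s : seq T) : uniq s -> C (subg_of (induced_ker_group s)).
Proof.
elim: s => [_|x s IH /= /andP[xs us]].
  apply: (Melnikov_trivial MC CG) => -[e es].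
  by apply: val_inj; exact: induced_ker_nil es.
have [CM _] := iffRL (Melnikov_ker_image MC ealpha) CG.
have ev_ker (e : subg_of (induced_ker_group (x :: s))) :
    ((sgval e).2 (1, x)).1 \in mul_ker_group alpha.
  by rewrite inE; have [_ ->] := induced_ker_eval x (subgP e).
have [|ev evE] := @multiplicative_of_morph (subg_of (induced_ker_group (x :: s)))
    (subg_of (mul_ker_group alpha)) (fun e => Subg (ev_ker e)).
  move=> e f; apply: val_inj; rewrite /= permM.
  have [ex _] := induced_ker_eval x (subgP e).
  case: ((sgval e).2 (1, x)) ex => g y /= ->.
  have /induced_kerP[/induced_extP[_ gf] _ _] := subgP f.
  by rewrite -[in LHS](mulg1 g) gf.
have sub : induced_ker_group s \subset induced_ker_group (x :: s).
  apply/fintype.subsetP => e /induced_kerP[Ee e1 es]; apply/induced_kerP; split => //.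
  by move=> y; rewrite inE negb_or => /andP[_ /es].
have [i iE] := subg_of_sub sub.
apply/(Melnikov_exact MC (i := i) (p := ev)); last by split => //; exact: IH.
- by move=> e f /(congr1 val); rewrite /= !iE; exact: subg_inj.
- apply/epi_exP => -[m mK].
  have [|e es [ex _]] := @induced_ker_surj (x :: s) x m (mem_head _ _).
    by apply/eqP; move: mK; rewrite inE.
  by exists (Subg es); rewrite evE; apply: val_inj; rewrite /= ex.
- move=> e; split=> [/(congr1 val)|[f <-]]; rewrite evE /=.
    move=> ex; have es : sgval e \in induced_ker_group s.
      have [e2 _] := induced_ker_eval x (subgP e).
      have /induced_kerP[Ee e1 es] := subgP e.
      apply/induced_kerP; split => // y ys.
      have [->|yx] := eqVneq y x; last by apply: es; rewrite inE negb_or yx.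
      by case: ((sgval e).2 (1, x)) ex e2 => g z /= -> ->.
    by exists (Subg es); apply: val_inj; rewrite /= iE.
  apply: val_inj; rewrite /= iE.
  by have /induced_kerP[_ _ ->] := subgP f.
Qed.

Lemma induced_ext_Melnikov : C (subg_of E).
Proof.
have [|p pE] := @multiplicative_of_morph (subg_of E) B (fun e => (sgval e).1).
  by [].
have sub : induced_ker_group (enum {: T}) \subset E.
  by apply/fintype.subsetP => e /induced_kerP[].
have [i iE] := subg_of_sub sub.
apply/(Melnikov_exact MC (i := i) (p := p)).
- by move=> e f /(congr1 val); rewrite /= !iE; exact: subg_inj.
- apply/epi_exP => b; have [e Ee eb] := induced_ext_epi b.
  by exists (Subg Ee); rewrite pE.
- move=> e; rewrite pE; split=> [e1|[f <-]]; last first.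
    by rewrite iE; have /induced_kerP[] := subgP f.
  have es : sgval e \in induced_ker_group (enum {: T}).
    apply/induced_kerP; split => //; first exact: subgP.
    by move=> x; rewrite mem_enum.
  by exists (Subg es); apply: val_inj; rewrite /= iE.
by split => //; apply: induced_ker_Melnikov; exact: enum_uniq.
Qed.

(** Right translation by an element of [A] preserves the coset [A] itself, whose representative is
    [rep1]; comparing projections then gives both claims. *)
Lemma induced_ext_eval (e : B * {perm Y}) : e \in E -> e.1 \in A ->
  e.2 (1, rep1) = ((e.2 (1, rep1)).1, rep1) /\
  sgval (alpha (e.2 (1, rep1)).1) = e.1.
Proof.
move=> /induced_extP[pe _] eA.
have := pe (1, rep1); rewrite /ext_proj /= multiplicative1 !mul1g.
case: (e.2 (1, rep1)) => g x /= gx.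
have x1 : x = rep1.
  apply: transversal_rep_inj; rewrite /= invg1 mulg1.
  by rewrite -(groupMl _ (subgP (alpha g))) gx.
by split; [rewrite x1|rewrite -gx x1 /= mulg1].
Qed.

(** Projectivity concerns [L], not [Gam], so [nu] is lifted to the induced extension of [B]; on
    [Gam] this lift lies over [A], where evaluation at [(1, rep1)] is a homomorphism to [G]. *)
Lemma projective_group_subgroup_lift (L : topologicalGroupType)
    (Gam : closedSubgroup L) (mu : {multiplicative Gam -> subg_of A})
    (nu : {multiplicative L -> B}) :
  projective_group C L -> fin_continuous nu -> epi nu ->
  (forall g, nu (csub_incl g) = sgval (mu g)) ->
  exists2 eta : {multiplicative Gam -> G},
    fin_continuous eta & forall g, alpha (eta g) = mu g.
Proof.
move=> [_ liftL] cnu enu numu.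
have [|p pE] := @multiplicative_of_morph (subg_of E) B (fun e => (sgval e).1).
  by [].
have [|psi cpsi ppsi] := liftL (subg_of E) B nu p induced_ext_Melnikov CB cnu enu.
  apply/epi_exP => b; have [e Ee eb] := induced_ext_epi b.
  by exists (Subg Ee); rewrite pE.
pose ev (e : subg_of E) := ((sgval e).2 (1, rep1)).1.
have psiA g : (sgval (psi (csub_incl g))).1 = sgval (mu g).
  by rewrite -pE ppsi numu.
have psiE (g : Gam) := induced_ext_eval (subgP (psi (csub_incl g))).
have [|eta etaE] := @multiplicative_of_morph Gam G (fun g => ev (psi (csub_incl g))).
  move=> g h; rewrite csub_inclM gmulfM /ev /= permM.
  have [|+ _] := psiE g; first by rewrite psiA subgP.
  have /induced_extP[_ gf] := subgP (psi (csub_incl h)).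
  case: ((sgval (psi (csub_incl g))).2 (1, rep1)) => a t /= [->].
  by rewrite -{1}[a]mulg1 gf.
exists eta => [|g].
  rewrite (funext etaE); apply/fin_continuousP => Z.
  have /fin_continuousP/(_ (ev @^-1` Z)) := fin_continuous_comp
    (@csub_incl_continuous L Gam) cpsi.
  by [].
rewrite etaE; apply: val_inj; rewrite /= /ev.
by have [|_ ->] := psiE g; rewrite psiA ?subgP.
Qed.

End InducedExtension.

(** * Twisting lifts by cocycles with values in a finite kernel *)

Lemma fin_continuous2 (T : topologicalType) (F1 F2 F : finGroupType)
    (f : T -> F1) (g : T -> F2) (h : F1 -> F2 -> F) :
  fin_continuous f -> fin_continuous g -> fin_continuous (fun t => h (f t) (g t)).
Proof.
move=> /fin_continuousP cf /fin_continuousP cg; apply/fin_continuousP => A.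
rewrite openE => x Ax.
apply: (filterS (P := f @^-1` [set f x] `&` g @^-1` [set g x])).
  by move=> y /= [-> ->].
by apply: open_nbhs_nbhs; split => //; apply: openI.
Qed.

Lemma discrete_continuous2 (T : topologicalType) (D1 D2 : discreteTopologicalType)
    (f : D1 * D2 -> T) : continuous f.
Proof.
move=> [x y] U /nbhs_singleton Uxy; exists ([set x], [set y]).
  by split; exact: discrete_set1.
by move=> [x' y'] [/= -> ->].
Qed.

(** Makes a finite group available as a coefficient group for [H1]. *)
Definition discrete_group (F : finGroupType) : Type := discrete_topology F.

Section DiscreteGroup.
Variable F : finGroupType.
Local Notation D := (discrete_group F).

HB.instance Definition _ := DiscreteTopology.copy D (discrete_topology F).
HB.instance Definition _ := monoid.Group.copy D F.

Lemma discrete_mulg_continuous : continuous (fun x : D * D => x.1 * x.2).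
Proof. exact: discrete_continuous2. Qed.

Lemma discrete_invg_continuous : continuous (fun x : D => x^-1).
Proof.
move=> x U /nbhs_singleton Ux; apply: (@filterS _ (nbhs x) _ [set x]) => [_ ->//|].
exact: discrete_set1.
Qed.

HB.instance Definition _ :=
  isTopologicalGroup.Build D discrete_mulg_continuous discrete_invg_continuous.

Lemma discrete_group_pro (C : finGroupType -> Prop) :
  Melnikov_formation C -> C F -> pro C D.
Proof.
move=> MC CF; split.
  split; last exact/zero_dimension_totally_disconnected/discrete_zero_dimension.
    exact/finite_compact/(@finite_finset F).
  exact: discrete_hausdorff.
move=> H f _ ef; have [|g gE] := @multiplicative_of_morph F H f.
  by move=> x y; exact: (@gmulfM _ _ f).
apply: (Melnikov_quotient MC (f := g)) => //.
by rewrite (_ : (g : F -> H) = f)//; exact/funext.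
Qed.

End DiscreteGroup.

(** * Weak solutions from surjectivity of restriction *)

Lemma H1_restriction_epi_projective_pair (C : finGroupType -> Prop)
    (L : topologicalGroupType) (Gam : closedSubgroup L) :
  Melnikov_formation C -> projective_group C L ->
  (forall (A : topologicalGroupType) (ac : contAction L A), pro C A ->
     epi (H1_restriction Gam ac)) ->
  projective_pair C Gam.
Proof.
move=> MC projL resH1 E.
have [t0 ct0 bt0] := projL.2 _ _ (dep_nu E) (dep_beta E) (dep_CH E) (dep_CB E)
  (@dep_nu_continuous _ _ _ E) (@dep_nu_epi _ _ _ E) (@dep_beta_epi _ _ _ E).
have [eta ceta aeta] := projective_group_subgroup_lift (@dep_alpha_epi _ _ _ E) MC
  (dep_CG E) (dep_CB E) projL (@dep_nu_continuous _ _ _ E) (@dep_nu_epi _ _ _ E) (@dep_nu_mu _ _ _ E).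
set H := dep_H E in t0 ct0 bt0 *; set beta := dep_beta E in bt0.
pose K := mul_ker_group beta.
have [CK _] := iffRL (Melnikov_ker_image MC (@dep_beta_epi _ _ _ E)) (dep_CH E).
have tK l (k : subg_of K) : t0 l * sgval k * (t0 l)^-1 \in K.
  have := subgP k; rewrite !inE !gmulfM multiplicativeV => /eqP ->.
  by rewrite mulg1 mulgV.
pose M : topologicalGroupType := discrete_group (subg_of K).
(* [L] acts on the kernel of [beta] by conjugation through [t0]; this is continuous because [t0] is
   locally constant. *)
pose act (l : L) (k : M) : M := Subg (tK l k).
have act1 k : act 1 k = k.
  by apply: val_inj; rewrite /= multiplicative1 invg1 mulg1 mul1g.
have actM l m k : act (l * m) k = act l (act m k).
  by apply: val_inj; rewrite /= gmulfM invgM !mulgA.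
have act_morph l : {morph act l : a b / a * b}.
  by move=> a b; apply: val_inj; rewrite /= !mulgA mulgVK.
have cact : continuous (fun p : L * M => act p.1 p.2).
  move=> [l k] U /nbhs_singleton Ulk.
  exists (t0 @^-1` [set t0 l], [set k]).
    split; last exact: (@discrete_set1 (discrete_topology (subg_of K))).
    by apply: open_nbhs_nbhs; split => //; exact: (iffLR (fin_continuousP _) ct0).
  move=> [l' k'] [/= tl ->]; rewrite (_ : act l' k = act l k)//.
  by apply: val_inj; rewrite /= tl.
pose ac := ContAction act1 actM act_morph cact.
have xK g : sgval (eta g) * (t0 (csub_incl g))^-1 \in K.
  rewrite inE gmulfM multiplicativeV bt0 dep_beta_alpha aeta dep_nu_mu.
  by rewrite mulgV.
(* The discrepancy between the lifts: [eta g = x g * t0 g], and multiplicativity of both lifts is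
   the cocycle identity for [x]. *)
pose x (g : Gam) : M := Subg (xK g).
have cx : continuous x.
  apply: (iffRL (fin_continuous_sgval (G := K) x)).
  apply: (@fin_continuous2 _ _ _ _ eta (t0 \o @csub_incl L Gam)
    (fun a b => sgval a * b^-1)) => //.
  by apply: fin_continuous_comp => //; exact: csub_incl_continuous.
have xM (g h : Gam) : x (g * h) = x g * res_action Gam ac g (x h).
  by apply: val_inj; rewrite /= !gmulfM invgM !mulgA mulgVK.
have [c cE] := iffLR (epi_exP _) (resH1 M ac (discrete_group_pro MC CK))
  (\pi_(H1 (res_action Gam ac))%qT (Cocycle cx xM)).
have /eqmodP/asboolP[a xa] := cE.
(* The representative used in the definition of [H1_restriction], so [xa] expresses [x] directly
   through [y] and [a]. *)
pose y : cocycle ac := generic_quotient.repr c.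
(* The cocycle identity makes [y l * t0 l] a homomorphism; conjugating it by [a] absorbs the
   coboundary, so that on [Gam] it becomes [x g * t0 g = eta g]. As [y l] and [a] lie in the kernel
   of [beta], it still lifts [nu]. *)
have [|theta thetaE] := @multiplicative_of_morph L H
  (fun l => (sgval a)^-1 * sgval (y l) * t0 l * sgval a).
  by move=> l m; rewrite cocycleM gmulfM /= !mulgA !mulgK !mulgVK.
exists eta, theta; split=> [|//|l|g].
- split => //; rewrite (funext thetaE).
  apply: (@fin_continuous2 _ _ _ _ (y : L -> subg_of K) t0
    (fun k h => (sgval a)^-1 * sgval k * h * sgval a)) => //.
  exact: (@cocycle_continuous _ _ _ y).
- rewrite thetaE !gmulfM multiplicativeV bt0.
  have /eqP-> : beta (sgval a) == 1 by have := subgP a; rewrite inE.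
  have /eqP-> : beta (sgval (y l)) == 1 by have := subgP (y l); rewrite inE.
  by rewrite mulg1 invg1 !mul1g.
- have /(congr1 (@sgval _ K)) /= := xa g.
  move=> /(canRL (mulgVK _)) ->.
  by rewrite thetaE !mulgA mulgVK.
Qed.

Theorem proposition2p12 (C : finGroupType -> Prop)
    (L : topologicalGroupType) (Gam : closedSubgroup L) :
  Melnikov_formation C -> projective_group C L -> pro C Gam ->
  (projective_pair C Gam <->
   forall (A : topologicalGroupType) (ac : contAction L A), pro C A ->
     epi (H1_restriction Gam ac)).
Proof.
move=> MC projL proG; split=> [PG A ac proA|].
  exact: (projective_pair_H1_restriction_epi MC projL.1).
exact: H1_restriction_epi_projective_pair.
Qed.
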